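(* Let $d\ge 2$ and let $\Delta$ be a balanced $(d-1)$-dimensional simplicial complex with exactly $3d$ vertices that is a $\mathbb{Q}$-homology $(d-1)$-manifold. If $\beta_1(\Delta;\mathbb{Q})\neq 0$ and $\beta_2(\Delta;\mathbb{Q})=0$, then $\Delta$ is isomorphic (as a simplicial complex) to $BM_d$.
   Context: A (finite) simplicial complex $\Delta$ on vertex set $V$ is a collection of subsets of $V$ (faces) closed under inclusion and containing every $\{v\}$, $v\in V$; $\dim\sigma=|\sigma|-1$. A $(d-1)$-dimensional simplicial complex is balanced if its graph is $d$-colorable, i.e. there is $\kappa:V\to\{1,\dots,d\}$ with $\kappa(u)\ne\kappa(v)$ for every edge $\{u,v\}\in\Delta$. The link of a face $\sigma$ is $\mathrm{lk}_\Delta\sigma=\{\tau\setminus\sigma:\sigma\subseteq\tau\in\Delta\}$. $\Delta$ is a $(d-1)$-dimensional $\mathbb{Q}$-homology manifold if $\tilde H_*(\mathrm{lk}_\Delta\sigma;\mathbb{Q})\cong\tilde H_*(\mathbb{S}^{d-1-|\sigma|};\mathbb{Q})$ for every nonempty face $\sigma\in\Delta$. $\beta_i(\Delta;\mathbb{Q})=\dim_{\mathbb{Q}}\tilde H_i(\Delta;\mathbb{Q})$ are the reduced Betti numbers. The complex $BM_d$ is defined as follows. Let $\Delta_1,\Delta_2,\Delta_3$ be boundary complexes of $d$-dimensional cross-polytopes with $V(\Delta_1)=\{x_1,\dots,x_d\}\cup\{y_1,\dots,y_d\}$, $V(\Delta_2)=\{y'_1,\dots,y'_d\}\cup\{z_1,\dots,z_d\}$,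 $V(\Delta_3)=\{z'_1,\dots,z'_d\}\cup\{x'_1,\dots,x'_d\}$, where in each of them the two vertices with index $i$ are antipodal and have color $i$. $BM_d$ is the complex obtained by forming two connected sums (identifying $y_i$ with $y'_i$, and $z_i$ with $z'_i$) followed by a handle addition (identifying $x_i$ with $x'_i$); in each operation the two identified facets are removed. Explicitly, $BM_d$ is the simplicial complex on the $3d$ vertices $x_i,y_i,z_i$ ($1\le i\le d$) whose facets are all sets $\{a_1,\dots,a_d\}$ such that, for one of the three pairs $(p,q)\in\{(x,y),(y,z),(z,x)\}$, $a_i\in\{p_i,q_i\}$ for every $i$, excluding the three sets $\{x_1,\dots,x_d\}$, $\{y_1,\dots,y_d\}$, $\{z_1,\dots,z_d\}$. *)

(* Defs.v *)
From HB Require Import structures.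
From mathcomp Require Import all_boot all_order all_algebra.

Set Implicit Arguments.
Unset Strict Implicit.
Unset Printing Implicit Defensive.

Import GRing.Theory.

Local Open Scope ring_scope.

Section SimplicialComplexes.

Variable V : finType.
Implicit Types (D : {set {set V}}) (F G : {set V}) (i : int).

(* A complex is given by its set of faces; [V] is exactly its vertex set.     *)
Definition simplicial_complex D : Prop :=
  (forall F G, F \in D -> G \subset F -> G \in D) /\
  (forall v : V, [set v] \in D).

Definition face_dim F : int := #|F|%:Z - 1.

Definition complex_dim D : int := (\max_(F in D) #|F|)%N%:Z - 1.

Definition balanced (d : nat) D : Prop :=
  exists kappa : V -> 'I_d,
    forall u v : V, u != v -> [set u; v] \in D -> kappa u != kappa v.

(* The link is again a set of faces over [V], although its own vertices only  *)
(* form a subset of [V]; reduced homology below is therefore defined for any  *)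
(* family of subsets closed under inclusion.                                  *)
Definition link D F : {set {set V}} := [set G :\: F | G in D & F \subset G].

(* Rational chains on the full simplex with vertex set [V]; all simplices,    *)
(* including the empty one (of dimension -1), are oriented by the enumeration *)
(* order of [V].                                                              *)
Definition chain : vectType rat := {ffun {set V} -> rat^o}.

Definition simplex_chain F : chain := [ffun G => (G == F)%:R].

Definition vertex_pos F (v : V) : nat :=
  #|[set u in F | (enum_rank u < enum_rank v)%N]|.

Definition simplex_boundary F : chain :=
  \sum_(v in F) (-1) ^+ vertex_pos F v *: simplex_chain (F :\ v).

Definition boundary_fun (c : chain) : chain :=
  \sum_(F : {set V}) (c F : rat) *: simplex_boundary F.

Fact boundary_fun_is_linear : linear boundary_fun.
Proof.
move=> a b c; rewrite /boundary_fun scaler_sumr -big_split /=.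
by apply: eq_bigr => F _; rewrite !ffunE scalerDl scalerA.
Qed.

HB.instance Definition _ :=
  GRing.isLinear.Build rat chain chain _ boundary_fun boundary_fun_is_linear.

Definition boundary : 'End(chain) := linfun boundary_fun.

Definition chains D i : {vspace chain} :=
  (\sum_(F in D | face_dim F == i) <[simplex_chain F]>)%VS.

Definition cycles D i : {vspace chain} := (chains D i :&: lker boundary)%VS.

Definition boundaries D i : {vspace chain} := (boundary @: chains D (i + 1))%VS.

Fact boundary_simplex F : boundary (simplex_chain F) = simplex_boundary F.
Proof.
rewrite lfunE /= /boundary_fun (bigD1 F) //= ffunE eqxx scale1r big1 ?addr0 //.
by move=> G /negPf nGF; rewrite ffunE nGF scale0r.
Qed.

Fact vertex_posD1 F u v : v \in F ->
  vertex_pos F u = ((enum_rank v < enum_rank u) + vertex_pos (F :\ v) u)%N.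
Proof.
move=> vF; rewrite /vertex_pos (cardsD1 v) inE vF /=; congr (_ + _)%N.
by apply: eq_card => w; rewrite !inE andbA.
Qed.

Fact boundary_boundary c : boundary (boundary c) = 0.
Proof.
rewrite [boundary c]lfunE /= /boundary_fun linear_sum big1 // => F _.
rewrite linearZ /= /simplex_boundary linear_sum /=.
under eq_bigr => v _ do
  rewrite linearZ /= boundary_simplex /simplex_boundary scaler_sumr.
set S := \sum_(v in F) _; suff SN: S = - S.
  suff -> : S = 0 by rewrite scaler0.
  apply/eqP; have: S *+ 2 == 0 by rewrite mulr2n {1}SN addNr.
  by rewrite -scaler_nat scaler_eq0 Num.Theory.pnatr_eq0.
rewrite {1}/S (exchange_big_dep (mem F)) /=; last first.
  by move=> v u vF; rewrite !inE => /andP[].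
rewrite /S -sumrN; apply: eq_bigr => u uF; rewrite -sumrN.
have eqP v : (v \in F) && (u \in F :\ v) = (v \in F :\ u).
  by rewrite !inE uF andbT andbC eq_sym.
rewrite (eq_bigl _ _ eqP); apply: eq_bigr => v; rewrite !inE => /andP[nvu vF].
rewrite !scalerA -scaleNr -!exprD !setDDl [[set v] :|: _]setUC.
congr (_ *: _); rewrite (vertex_posD1 v uF) (vertex_posD1 u vF).
have: enum_rank u != enum_rank v by rewrite (inj_eq enum_rank_inj) eq_sym.
rewrite neq_ltn => /orP[lt | lt]; rewrite lt ltnNge (ltnW lt) /= !add0n;
  by rewrite !exprD ?expr1 ?mulN1r ?mulNr ?mulrN ?opprK mulrC.
Qed.

Fact boundaries_sub_cycles D i :
  (forall F G, F \in D -> G \subset F -> G \in D) ->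
  (boundaries D i <= cycles D i)%VS.
Proof.
move=> subD; rewrite subv_cap; apply/andP; split; last first.
  apply/subvP => _ /memv_imgP[c _ ->]; rewrite memv_ker.
  exact/eqP/boundary_boundary.
rewrite /boundaries limg_sum; apply/subv_sumP => F /andP[FD /eqP dimF].
rewrite limg_line -memvE boundary_simplex; apply: rpred_sum => v vF.
apply: rpredZ; rewrite memvE; apply: (sumv_sup (F :\ v)) => //.
rewrite (subD F) ?subsetDl //= /face_dim.
move: dimF; rewrite /face_dim (cardsD1 v) vF PoszD => dimF.
by apply/eqP; apply: (addIr 1); rewrite -dimF subrK addrAC subrr add0r.
Qed.

(* dim of H~_i(D; Q) = cycles / boundaries; by [boundaries_sub_cycles] the    *)
(* subtraction of naturals is not truncated.                                  *)
Definition reduced_betti D i : nat := (\dim (cycles D i) - \dim (boundaries D i))%N.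

(* H~_i(S^k; Q) is Q for i = k and 0 otherwise, also for S^(-1) = {empty}.    *)
Definition sphere_reduced_betti (k i : int) : nat := (i == k).

(* Finite-dimensional vector spaces are isomorphic iff their dimensions agree. *)
Definition homology_manifold (d : nat) D : Prop :=
  forall F, F \in D -> F != set0 ->
    forall i, reduced_betti (link D F) i =
              sphere_reduced_betti (d%:Z - 1 - #|F|%:Z) i.

End SimplicialComplexes.

Definition complex_isomorphic (V W : finType)
    (D : {set {set V}}) (E : {set {set W}}) : Prop :=
  exists2 f : V -> W, bijective f & forall F : {set V}, (F \in D) = (f @: F \in E).

(* The vertices x_i, y_i, z_i are the pairs (0, i), (1, i), (2, i), so that   *)
(* the pairs (x, y), (y, z), (z, x) are the (p, ordS p).                      *)
Definition BM_facet (d : nat) (F : {set 'I_3 * 'I_d}) : bool :=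
  [exists p : 'I_3, exists a : {ffun 'I_d -> 'I_3},
     [forall i, (a i == p) || (a i == ordS p)] &&
     (F == [set (a i, i) | i : 'I_d])] &&
  [forall p : 'I_3, F != [set (p, i) | i : 'I_d]].

Definition BM (d : nat) : {set {set 'I_3 * 'I_d}} :=
  [set F : {set 'I_3 * 'I_d} |
    [exists G : {set 'I_3 * 'I_d}, BM_facet G && (F \subset G)]].

(* Main.v *)
From HB Require Import structures.
Require Import Defs.
From mathcomp Require Import all_boot all_order all_algebra.
From mathcomp Require Import zify ring lra.

Set Implicit Arguments.
Unset Strict Implicit.
Unset Printing Implicit Defensive.

Import GRing.Theory Num.Theory.

Local Open Scope ring_scope.

(** A nonzero first Betti number gives a rational cocycle [phi] on the edges that is
not a coboundary ([betti1_cocycle]). All the rest is combinatorial and uses only the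
following consequences of the manifold condition: every face lies in a facet with
all [d] colours, every face with [d - 1] colours lies in exactly two facets, and
vertex links are connected when [3 <= d]. By the first two, every nonempty face
extends by at least two vertices of each colour that it misses
([face_two_extensions]).

Let [3 <= d]. A colour class with two vertices would make the complex a suspension
over a connected link, and [phi] a coboundary; so every class has at least, hence
exactly, three vertices ([color_class_card3]). By pigeonhole among three vertices,
links are connected enough for a potential of [phi] on the edges of two colours to
extend to the whole complex ([coboundary_two_colors]).

Fix three colours. In the link of a vertex of the first colour, the vertices of the
other two colours span a bipartite graph on at most 3 + 3 vertices with all degrees
at least two. Any two of the three graphs cover all edges of the last two colours,
so if two of them had a connected intersection, the potentials of [phi] on the two
would glue ([coboundary_two_cones]). Hence all three intersections are disconnected.
Up to renumbering, a finite enumeration ([classify_links]) leaves only two kinds of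
families: that of a projective plane with nine vertices, on which [phi] is a
coboundary because 2 is invertible, and those where the vertices of each colour can
be given letters x, y, z such that three distinct letters never form a face and
exactly two distinct letters always do ([triple_labels]).

For four colours, counting extensions shows that the letters of two colours
are matched in the same way whatever the third colour
([triple_labelling_unique]), so the letters can be chosen globally
([labelling_exists]). Facets are then words in two letters. As every face extends
twice, all nonconstant words in two letters are facets; as a face with [d - 1]
colours lies in only two facets, constant words are not
([labelled_isomorphic]). For [d = 2] the complex is a bipartite 2-regular graph on
3 + 3 vertices, and opposite vertices of this hexagon get the same letter. *)

(** * Rational chains on a simplex *)

Section Homology.

Variable V : finType.
Implicit Types (D L : {set {set V}}) (F G : {set V}) (u v w : V).

(** Links are families of this kind: closed under inclusion, on part of [V]. *)
Definition closed_family D := forall F G, F \in D -> G \subset F -> G \in D.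

Lemma face_dimE F (n : nat) : (face_dim F == n%:Z - 1) = (#|F| == n).
Proof. by rewrite /face_dim (inj_eq (addIr _)) eqz_nat. Qed.

Lemma memv_chains D i F :
  F \in D -> face_dim F == i -> simplex_chain F \in chains D i.
Proof. by move=> FD Fi; rewrite memvE; apply: (sumv_sup F); rewrite ?FD. Qed.

Lemma chains_subv D i (U : {vspace chain V}) :
  (forall F, F \in D -> face_dim F == i -> simplex_chain F \in U) ->
  (chains D i <= U)%VS.
Proof.
by move=> DU; apply/subv_sumP => F /andP[FD Fi]; rewrite -memvE; apply: DU.
Qed.

Lemma simplex_chainE F G : simplex_chain F G = (G == F)%:R.
Proof. by rewrite ffunE. Qed.

Lemma dim_chains D i :
  \dim (chains D i) = #|[set F in D | face_dim F == i]|.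
Proof.
set S := [set F in D | _]; pose X := [seq simplex_chain F | F <- enum S].
have -> : chains D i = <<X>>%VS.
  rewrite span_def big_map big_enum /=.
  by apply: eq_bigl => F; rewrite inE.
suff /eqP-> : free X by rewrite size_map -cardE.
have sX : size X == #|S| by rewrite size_map -cardE.
rewrite -[X]/(tval (Tuple sX)); apply/freeP => k k0 j.
have jS : (j < size (enum S))%N by rewrite -cardE.
pose F0 := nth set0 (enum S) j.
have /= := congr1 (fun c : chain V => c F0) k0.
rewrite sum_ffunE [RHS]ffunE (bigD1 j) //= big1 => [|l lj].
  rewrite addr0 ffunE (nth_map set0) // simplex_chainE eqxx.
  by rewrite /GRing.scale /= mulr1.
rewrite ffunE (nth_map set0) -?cardE // simplex_chainE.
rewrite nth_uniq ?enum_uniq // -?cardE // eq_sym.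
by rewrite (inj_eq val_inj) (negPf lj) scaler0.
Qed.

(** The linear form on chains that takes the value [h v] on the vertex [v] and
vanishes on simplices of any other dimension. *)
Definition vertex_form (h : V -> rat) (c : chain V) : rat^o :=
  \sum_v h v * c [set v].

Fact vertex_form_linear h : linear (vertex_form h).
Proof.
move=> a b c; rewrite /vertex_form scaler_sumr -big_split /=.
by apply: eq_bigr => v _; rewrite !ffunE /GRing.scale /= mulrDr mulrCA.
Qed.

HB.instance Definition _ h := GRing.isLinear.Build rat (chain V) rat^o _
  (vertex_form h) (vertex_form_linear h).

Lemma vertex_form1 h v : vertex_form h (simplex_chain [set v]) = h v.
Proof.
rewrite /vertex_form (bigD1 v) //= simplex_chainE eqxx mulr1 big1 ?addr0 // => w.
by move=> /negPf wv; rewrite simplex_chainE (inj_eq set1_inj) wv mulr0.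
Qed.

Lemma vertex_pos1 v : vertex_pos [set v] v = 0%N.
Proof.
apply/eqP; rewrite cards_eq0; apply/eqP/setP => w; rewrite !inE.
by case: eqP => // ->; rewrite ltnn.
Qed.

Lemma vertex_pos2 u v : u != v ->
  vertex_pos [set u; v] u = (enum_rank v < enum_rank u)%N.
Proof.
move=> uv; rewrite (@vertex_posD1 _ _ u v) ?inE ?eqxx ?orbT //.
have -> : [set u; v] :\ v = [set u].
  by rewrite setUC setU1K // !inE eq_sym.
by rewrite vertex_pos1 addn0.
Qed.

Lemma vertex_pos3 u v w : u != v -> v != w -> u != w ->
  vertex_pos [set u; v; w] u =
  ((enum_rank w < enum_rank u) + (enum_rank v < enum_rank u))%N.
Proof.
move=> uv vw uw; rewrite (@vertex_posD1 _ _ u w) ?inE ?eqxx ?orbT //.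
have -> : [set u; v; w] :\ w = [set u; v].
  by rewrite setUC setU1K // !inE negb_or ![w == _]eq_sym uw.
by rewrite vertex_pos2.
Qed.

Lemma rank_ltC u v : u != v ->
  (enum_rank v < enum_rank u)%N = ~~ (enum_rank u < enum_rank v)%N.
Proof.
by move=> uv; rewrite -leqNgt ltn_neqAle (inj_eq val_inj) (inj_eq enum_rank_inj)
  eq_sym uv.
Qed.

Lemma simplex_boundary1 v : simplex_boundary [set v] = simplex_chain set0.
Proof. by rewrite /simplex_boundary big_set1 vertex_pos1 scale1r setDv. Qed.

(** The incidence sign that makes [edge_sign u v *: simplex_chain [set u; v]]
the edge oriented from [u] to [v]. *)
Definition edge_sign u v : rat := (-1) ^+ (enum_rank v < enum_rank u)%N.

Lemma edge_signC u v : u != v -> edge_sign v u = - edge_sign u v.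
Proof.
move=> uv; rewrite /edge_sign (rank_ltC uv).
by case: ltnP; rewrite /= ?expr1 ?expr0 ?opprK.
Qed.

Lemma simplex_boundary2 u v : u != v ->
  simplex_boundary [set u; v] =
  edge_sign u v *: (simplex_chain [set v] - simplex_chain [set u]).
Proof.
move=> uv; rewrite /simplex_boundary big_setU1 ?inE //= big_set1 vertex_pos2 //.
rewrite {2}setUC vertex_pos2 1?eq_sym // -/(edge_sign u v) -/(edge_sign v u).
rewrite (edge_signC uv) scaleNr -scalerBr.
congr (_ *: (simplex_chain _ - simplex_chain _)).
  by rewrite setU1K ?inE.
by rewrite setUC setU1K // !inE eq_sym.
Qed.

Lemma simplex_boundary3 u v w : u != v -> v != w -> u != w ->
  exists2 s : rat, s != 0 &
  simplex_boundary [set u; v; w] =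
  s *: (edge_sign u v *: simplex_chain [set u; v] +
        edge_sign v w *: simplex_chain [set v; w] -
        edge_sign u w *: simplex_chain [set u; w]).
Proof.
move=> uv vw uw.
exists (edge_sign u v * edge_sign v w * edge_sign u w).
  by rewrite /edge_sign -!exprD signr_eq0.
have vu : v != u by rewrite eq_sym.
have wv : w != v by rewrite eq_sym.
have wu : w != u by rewrite eq_sym.
have Dv : [set u; v; w] = [set v; u; w] by rewrite [[set u; v]]setUC.
have Dw : [set u; v; w] = [set w; u; v] by rewrite setUC setUA.
have -> : simplex_boundary [set u; v; w] =
    (-1) ^+ vertex_pos [set u; v; w] u *: simplex_chain ([set u; v; w] :\ u) +
    ((-1) ^+ vertex_pos [set u; v; w] v *: simplex_chain ([set u; v; w] :\ v) +
    (-1) ^+ vertex_pos [set u; v; w] w *: simplex_chain ([set u; v; w] :\ w)).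
  rewrite /simplex_boundary (eq_bigl [in u |: (v |: [set w])]) => [|x].
    by rewrite big_setU1 ?inE ?negb_or ?uv //= big_setU1 ?inE //= big_set1.
  by rewrite -setUA.
have -> : vertex_pos [set u; v; w] v =
    ((enum_rank w < enum_rank v) + (enum_rank u < enum_rank v))%N.
  by rewrite Dv vertex_pos3.
have -> : vertex_pos [set u; v; w] w =
    ((enum_rank v < enum_rank w) + (enum_rank u < enum_rank w))%N.
  by rewrite Dw vertex_pos3.
rewrite vertex_pos3 //.
have -> : [set u; v; w] :\ u = [set v; w].
  by rewrite -setUA setU1K // !inE negb_or uv.
have -> : [set u; v; w] :\ v = [set u; w].
  by rewrite Dv -setUA setU1K // !inE negb_or vu.
have -> : [set u; v; w] :\ w = [set u; v].
  by rewrite setUC setU1K // !inE negb_or wu.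
rewrite /edge_sign.
rewrite (rank_ltC uv) (rank_ltC vw) (rank_ltC uw) scalerBr scalerDr !scalerA.
rewrite -scaleNr -[RHS]addrA [RHS]addrC -[RHS]addrA.
congr (_ *: _ + (_ *: _ + _ *: _)); by do 3 case: (_ < _)%N.
Qed.

End Homology.

(** * Cocycles, connectedness and pairs of points from Betti numbers *)

Section Cohomology.

Variable V : finType.
Implicit Types (D L : {set {set V}}) (F G : {set V}) (u v w : V).

(** The form is a coordinate of the projection along [U]. *)
Lemma separating_form (U : {vspace chain V}) (c : chain V) : c \notin U ->
  exists2 psi : {linear chain V -> rat^o},
    forall x, x \in U -> psi x = 0 & psi c != 0.
Proof.
move=> cU; pose r (x : chain V) := x - projv U x.
have [G rG]: exists G, r c G != 0.
  apply/existsP; apply: contraR cU; rewrite negb_exists => /forallP r0.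
  suff /eqP : r c = 0 by rewrite subr_eq0 => /eqP->; apply: memv_proj.
  by apply/ffunP => G; rewrite [RHS]ffunE; apply/eqP; rewrite -[_ == _]negbK r0.
pose psi (x : chain V) : rat^o := r x G.
have psi_lin : linear psi.
  move=> a x y; rewrite /psi /r linearP /= !ffunE /=.
  by rewrite scalerBr opprD addrACA.
pose psiL := GRing.isLinear.Build rat (chain V) rat^o _ psi psi_lin.
exists (HB.pack_for {linear chain V -> rat^o} psi psiL) => //= x xU.
by rewrite /psi /r projv_id // subrr ffunE.
Qed.

(** A rational 1-cocycle is a function of ordered pairs; only its values on edges
matter. *)
Definition cocycle D (phi : V -> V -> rat) :=
  (forall u v, u != v -> phi v u = - phi u v) /\
  (forall u v w, u != v -> v != w -> u != w -> [set u; v; w] \in D ->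
     phi u v + phi v w = phi u w).

Definition coboundary D (phi : V -> V -> rat) :=
  exists f : V -> rat,
    forall u v, u != v -> [set u; v] \in D -> phi u v = f v - f u.

Lemma cards_set3 u v w : u != v -> v != w -> u != w -> #|[set u; v; w]| = 3%N.
Proof.
move=> uv vw uw; rewrite setUC cardsU1 cards2 uv !inE negb_or.
by rewrite ![w == _]eq_sym uw vw.
Qed.

(** On edges the form [vertex_form f \o boundary V] is the coboundary of [f]. *)
Lemma vertex_form_edge f u v : u != v ->
  vertex_form f (boundary V (simplex_chain [set u; v])) =
  edge_sign u v * (f v - f u).
Proof.
move=> uv; rewrite boundary_simplex simplex_boundary2 // linearZ linearB /=.
by rewrite !vertex_form1.
Qed.

(** A linear form that vanishes on boundaries but not on some cycle, evaluated on
oriented edges, is a cocycle; if it were a coboundary it would vanish on cycles. *)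
Lemma betti1_cocycle D : closed_family D -> reduced_betti D 1 <> 0%N ->
  exists2 phi, cocycle D phi & ~ coboundary D phi.
Proof.
move=> clD b1; have [c cZ cB]: exists2 c, c \in cycles D 1 & c \notin boundaries D 1.
  apply/subvPn/negP => /dimvS le; apply: b1.
  by apply/eqP; rewrite subn_eq0.
have [psi psi0 psic] := separating_form cB.
pose phi u v := edge_sign u v * psi (simplex_chain [set u; v]).
exists phi; first split.
- by move=> u v uv; rewrite /phi setUC edge_signC // mulNr.
- move=> u v w uv vw uw uvwD.
  have [s s0 E] := simplex_boundary3 uv vw uw.
  have: psi (boundary V (simplex_chain [set u; v; w])) = 0.
    apply/psi0/memv_img/memv_chains => //.
    by rewrite /face_dim cards_set3.
  rewrite boundary_simplex E linearZ /= => /eqP; rewrite scaler_eq0 (negPf s0) /=.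
  by rewrite -scaleNr !linearD /= !linearZ /= [X in _ + X]scaleNr subr_eq0 => /eqP.
case=> f fE; case/negP: psic.
suff /eqP: psi c - vertex_form f (boundary V c) = 0.
  move: cZ; rewrite memv_cap memv_ker => /andP[_ /eqP->].
  by rewrite linear0 subr0.
have: (chains D 1 <= lker (linfun psi - (linfun (vertex_form f) \o boundary V)%VF))%VS.
  apply: chains_subv => F FD; rewrite /face_dim => /eqP F2.
  have /eqP/cards2P[u [v [uv EF]]] : #|F| = 2%N by lia.
  subst F; rewrite memv_ker add_lfunE opp_lfunE comp_lfunE.
  rewrite !(lfunE psi, lfunE (vertex_form f)).
  rewrite /= vertex_form_edge // -fE //.
  rewrite /phi mulrA -expr2 /edge_sign sqrr_sign mul1r subrr //.
move: cZ; rewrite memv_cap => /andP[cC _] /subvP/(_ _ cC).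
rewrite memv_ker add_lfunE opp_lfunE comp_lfunE.
by rewrite !(lfunE psi, lfunE (vertex_form f)) => /eqP.
Qed.

(** Connectedness, stated for functions: the difference of two vertices is a cycle,
hence a boundary, and a function that is constant on edges kills boundaries. *)
Lemma betti0_connected L (h : V -> rat) : closed_family L ->
  reduced_betti L 0 = 0%N ->
  (forall u v, u != v -> [set u; v] \in L -> h u = h v) ->
  forall u v, [set u] \in L -> [set v] \in L -> h u = h v.
Proof.
move=> clL b0 hE u v uL vL.
have ZB : (cycles L 0 <= boundaries L 0)%VS.
  by rewrite -(geq_leqif (dimv_leqif_sup (boundaries_sub_cycles 0 clL)))
    -subn_eq0; apply/eqP.
have c_dim w : face_dim [set w] == 0 by rewrite /face_dim cards1.
have: simplex_chain [set u] - simplex_chain [set v] \in cycles L 0.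
  rewrite memv_cap memvB ?memv_chains //= memv_ker linearB /=.
  by rewrite !boundary_simplex !simplex_boundary1 subrr.
move/(subvP ZB)/memv_imgP => [c cC E].
suff : vertex_form h (boundary V c) = 0.
  by rewrite -E linearB /= !vertex_form1 => /eqP; rewrite subr_eq0 => /eqP.
have: (chains L (0 + 1) <= lker (linfun (vertex_form h) \o boundary V)%VF)%VS.
  apply: chains_subv => F FL; rewrite /face_dim => /eqP F2.
  have /eqP/cards2P[x [y [xy EF]]] : #|F| = 2%N by lia.
  subst F; rewrite memv_ker comp_lfunE (lfunE (vertex_form h)).
  rewrite /= vertex_form_edge // (hE x y) //.
  by rewrite subrr mulr0.
by move/subvP/(_ _ cC); rewrite memv_ker comp_lfunE (lfunE (vertex_form h)) => /eqP.
Qed.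

(** On a set of points the only boundary is 0, and the cycles are the kernel of the
map onto the chains of the empty face, so they have dimension one less than the
number of points. *)
Lemma betti0_two_points L : closed_family L -> set0 \in L ->
  (forall F, F \in L -> (#|F| <= 1)%N) -> reduced_betti L 0 = 1%N ->
  #|[set v | [set v] \in L]| = 2%N.
Proof.
move=> clL L0 L1 b0; set N := [set v | _].
have NE : #|N| = \dim (chains L 0).
  rewrite dim_chains -(card_imset _ set1_inj); apply: eq_card => F; rewrite !inE.
  apply/imsetP/andP => [[v vN ->]|[FL]].
    by move: vN; rewrite inE /face_dim cards1.
  rewrite -[0]/(1%:Z - 1) face_dimE => /cards1P[v Ev].
  by exists v; rewrite // inE -Ev.
have B0 : boundaries L 0 = 0%VS.
  apply/eqP; rewrite -subv0 /boundaries.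
  have: (chains L (0 + 1) <= 0)%VS.
    apply: chains_subv => F FL; rewrite /face_dim => /eqP F2.
    by have := L1 F FL; lia.
  by rewrite subv0 => /eqP->; rewrite limg0.
move: b0; rewrite /reduced_betti B0 dimv0 subn0 => Z1.
have := limg_ker_dim (boundary V) (chains L 0); rewrite -/(cycles L 0) Z1 -NE.
have [N0|/set0Pn[v]] := eqVneq N set0.
  have := dimvS (capvSl (chains L 0) (lker (boundary V))).
  by rewrite -/(cycles L 0) Z1 -NE N0 cards0.
rewrite inE => vL.
suff -> : (boundary V @: chains L 0)%VS = <[simplex_chain set0]>%VS.
  rewrite dim_vline; case: eqP => [E|_ <- //].
  have /eqP := congr1 (fun c : chain V => c set0) E.
  by rewrite simplex_chainE eqxx ffunE oner_eq0.
apply/eqP; rewrite eqEsubv -memvE; apply/andP; split.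
  rewrite /chains limg_sum; apply/subv_sumP => F /andP[FL].
  rewrite -[0]/(1%:Z - 1) face_dimE => /cards1P[w ->].
  by rewrite limg_line -memvE boundary_simplex simplex_boundary1 memv_line.
rewrite -(simplex_boundary1 v) -boundary_simplex; apply/memv_img/memv_chains => //.
by rewrite /face_dim cards1.
Qed.

End Cohomology.

(** * Facets of balanced homology manifolds *)

Section Manifolds.

Variables (V : finType) (d : nat) (D : {set {set V}}) (kappa : V -> 'I_d).
Hypotheses (hd : (2 <= d)%N) (hD : simplicial_complex D).
Hypothesis hman : homology_manifold d D.
Hypothesis hkappa :
  forall u v, u != v -> [set u; v] \in D -> kappa u != kappa v.
Implicit Types (F G : {set V}) (u v w : V).

Let clD : closed_family D := proj1 hD.

Lemma in_link F G : (G \in link D F) = [disjoint G & F] && (G :|: F \in D).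
Proof.
apply/imsetP/andP => [[H]|[GF HD]].
  rewrite inE => /andP[HD FH] ->; split.
    by rewrite disjoints_subset setDE subsetIr.
  by have := setID H F; rewrite (setIidPr FH) setUC => ->.
exists (G :|: F); first by rewrite inE HD subsetUr.
by rewrite setDUl setDv setU0; apply/esym/setDidPl.
Qed.

Lemma link_closed F : closed_family (link D F).
Proof.
move=> G H; rewrite !in_link => /andP[GF GD] HG.
by rewrite (disjointWl HG GF) (clD GD) // setSU.
Qed.

Lemma link_vertex F v : ([set v] \in link D F) = (v \notin F) && (v |: F \in D).
Proof. by rewrite in_link disjoints1. Qed.

Lemma face_inj F : F \in D -> {in F &, injective kappa}.
Proof.
move=> FD u v uF vF; apply: contra_eq => uv; apply: hkappa => //.
by apply: clD FD _; rewrite subUset !sub1set uF.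
Qed.

Lemma face_card F : F \in D -> (#|F| <= d)%N.
Proof.
by move/face_inj/card_in_imset => <-; rewrite (leq_trans (max_card _)) ?card_ord.
Qed.

(** The link of a face with no extension is the complex of the empty face, which has
no homology in the nonnegative degree where the link has homology. *)
Lemma face_extend F : F \in D -> F != set0 -> (#|F| < d)%N ->
  exists2 v, v \notin F & v |: F \in D.
Proof.
move=> FD F0 Fd; case: (pickP [pred v | (v \notin F) && (v |: F \in D)]).
  by move=> v /andP[]; exists v.
move=> noext; have := hman FD F0 (d%:Z - 1 - #|F|%:Z).
rewrite /sphere_reduced_betti eqxx /reduced_betti.
suff -> : cycles (link D F) (d%:Z - 1 - #|F|%:Z) = 0%VS by rewrite dimv0.
apply/eqP; rewrite -subv0; apply: subv_trans (capvSl _ _) _.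
apply: chains_subv => G GL /eqP dG.
have G0 : G = set0.
  apply/eqP; apply/set0Pn => -[v vG]; have := noext v.
  by rewrite /= -link_vertex (link_closed GL) ?sub1set.
by move: dG; rewrite G0 /face_dim cards0; lia.
Qed.

Lemma face_in_facet F : F \in D -> F != set0 ->
  exists G, [/\ G \in D, F \subset G & #|G| = d].
Proof.
move En : (d - #|F|)%N => n; elim: n F En => [|n IHn] F En FD F0.
  by exists F; split => //; have := face_card FD; lia.
have [|v vF vFD] := face_extend FD F0; first by lia.
have [||G [GD FG Gd]] := IHn (v |: F) _ vFD.
- by rewrite cardsU1 vF; lia.
- by apply/set0Pn; exists v; rewrite setU11.
by exists G; split=> //; apply: subset_trans FG; apply: subsetUr.
Qed.

Lemma ridge_two_facets F : F \in D -> #|F| = d.-1 ->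
  #|[set v | (v \notin F) && (v |: F \in D)]| = 2%N.
Proof.
move=> FD Fd; have F0 : F != set0 by rewrite -card_gt0; lia.
under eq_finset => v do rewrite -link_vertex.
apply: betti0_two_points.
- exact: link_closed.
- by rewrite in_link set0U FD -setI_eq0 set0I eqxx.
- move=> G; rewrite in_link => /andP[GF /face_card].
  by rewrite cardsU (eqP (_ : _ :&: _ == set0)) ?setI_eq0 // cards0; lia.
- have := hman FD F0 0; rewrite /sphere_reduced_betti => ->.
  by apply/eqP; rewrite eqb1; apply/eqP; lia.
Qed.

(** Some facet contains the face; the codimension one face obtained by dropping
from it the vertex of the missing colour lies in two facets. *)
Lemma face_two_extensions F (i : 'I_d) : F \in D -> F != set0 ->
  (forall v, v \in F -> kappa v != i) ->
  exists u v, [/\ u != v, kappa u = i, kappa v = i, u |: F \in D & v |: F \in D].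
Proof.
move=> FD F0 Fi; have [G [GD FG Gd]] := face_in_facet FD F0.
have kG : kappa @: G = setT.
  apply/eqP; rewrite eqEcard subsetT (card_in_imset (face_inj GD)).
  by rewrite cardsT card_ord Gd /=.
have /imsetP[w wG Ew] : i \in kappa @: G by rewrite kG inE.
have FGw : F \subset G :\ w.
  by rewrite subsetD1 FG; apply: contraL (eqxx i) => /Fi; rewrite -Ew eqxx.
have Gw : G :\ w \in D by apply: clD GD (subsetDl _ _).
have cGw : #|G :\ w| = d.-1 by have := cardsD1 w G; rewrite wG Gd; lia.
have ext_color v : v \notin G :\ w -> v |: (G :\ w) \in D -> kappa v = i.
  move=> vG vGD; have : i \in kappa @: (v |: (G :\ w)).
    suff -> : kappa @: (v |: (G :\ w)) = setT by rewrite inE.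
    apply/eqP; rewrite eqEcard subsetT (card_in_imset (face_inj vGD)).
    by rewrite cardsT card_ord cardsU1 vG cGw; lia.
  case/imsetP => x; rewrite !inE => /orP[/eqP->//|/andP[xw xG] Ex].
  by case/eqP: xw; apply: (face_inj GD) => //; rewrite -Ew.
have /eqP/cards2P[u [v [uv E]]] := ridge_two_facets Gw cGw.
have: u \in [set u; v] by rewrite !inE eqxx.
have: v \in [set u; v] by rewrite !inE eqxx orbT.
rewrite -E !inE => /andP[vG vD] /andP[uG uD].
exists u, v; split=> //; try by apply: ext_color; rewrite ?inE.
  by apply: clD uD _; rewrite setUS.
by apply: clD vD _; rewrite setUS.
Qed.

End Manifolds.

(** * Balanced complexes with twofold extensions *)

(** A complex with a proper vertex colouring in which every nonempty face can be
completed, in each colour that it misses, by at least two vertices. *)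
Record twofold_complex (V : finType) (d : nat) (D : {set {set V}})
    (kappa : V -> 'I_d) : Prop := TwofoldComplex {
  twofold_closed : closed_family D;
  twofold_vertex : forall v, [set v] \in D;
  twofold_color :
    forall u v, u != v -> [set u; v] \in D -> kappa u != kappa v;
  twofold_ext : forall F i, F \in D -> F != set0 ->
    (forall v, v \in F -> kappa v != i) ->
    exists u v, [/\ u != v, kappa u = i, kappa v = i,
                    u |: F \in D & v |: F \in D] }.

Section Twofold.

Variables (V : finType) (d : nat) (D : {set {set V}}) (kappa : V -> 'I_d).
Hypothesis hD : twofold_complex D kappa.
Implicit Types (F G : {set V}) (u v w : V) (i j k : 'I_d).

(** [edge] and [face3] do not require their vertices to be distinct; they are used on
vertices of distinct colours. *)
Definition edge u v := [set u; v] \in D.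
Definition face3 u v w := [set u; v; w] \in D.
Definition color_class i := [set v | kappa v == i].

Lemma edgeC u v : edge u v = edge v u.
Proof. by rewrite /edge setUC. Qed.

Lemma face3C u v w : face3 u v w = face3 v u w.
Proof. by rewrite /face3 [[set u; v]]setUC. Qed.

Lemma face3CA u v w : face3 u v w = face3 u w v.
Proof. by rewrite /face3 setUAC. Qed.

Lemma face3_edge u v w : face3 u v w -> [/\ edge u v, edge u w & edge v w].
Proof.
move=> uvw; split; apply: (twofold_closed hD uvw);
  by rewrite subUset !sub1set !inE !eqxx ?orbT.
Qed.

Lemma neq_color u v : kappa u != kappa v -> u != v.
Proof. by apply: contraNneq => ->. Qed.

Lemma vertex_ext u i : kappa u != i ->
  exists v w, [/\ v != w, kappa v = i, kappa w = i, edge u v & edge u w].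
Proof.
move=> ui; have [||v [w [vw vi wi vu wu]]] :=
  @twofold_ext _ _ _ _ hD _ i (twofold_vertex hD u).
- by apply/set0Pn; exists u; rewrite inE.
- by move=> v; rewrite inE => /eqP->.
by exists v, w; split; rewrite // /edge setUC.
Qed.

Lemma edge_ext u v i : edge u v -> kappa u != i -> kappa v != i ->
  exists w x, [/\ w != x, kappa w = i, kappa x = i, face3 u v w & face3 u v x].
Proof.
move=> uv ui vi; have [||w [x [wx wi xi wF xF]]] :=
  @twofold_ext _ _ _ _ hD _ i uv.
- by apply/set0Pn; exists u; rewrite !inE eqxx.
- by move=> w; rewrite !inE => /orP[]/eqP->.
by exists w, x; split; rewrite // /face3 setUC.
Qed.

Lemma face3_ext u v w i : face3 u v w ->
  kappa u != i -> kappa v != i -> kappa w != i ->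
  exists x y, [/\ x != y, kappa x = i, kappa y = i,
    [/\ face3 x u v, face3 x u w & face3 x v w] &
    [/\ face3 y u v, face3 y u w & face3 y v w]].
Proof.
move=> uvw ui vi wi; have [||x [y [xy xi yi xF yF]]] :=
  @twofold_ext _ _ _ _ hD _ i uvw.
- by apply/set0Pn; exists u; rewrite !inE eqxx.
- by move=> x; rewrite !inE -orbA => /or3P[]/eqP->.
exists x, y; split=> //; split.
all: [> apply: (twofold_closed hD xF) | apply: (twofold_closed hD xF)
  | apply: (twofold_closed hD xF) | apply: (twofold_closed hD yF)
  | apply: (twofold_closed hD yF) | apply: (twofold_closed hD yF)].
all: by rewrite !subUset !sub1set !inE !eqxx ?orbT.
Qed.

Section Cocycle.

Variable phi : V -> V -> rat.
Hypothesis phiZ : cocycle D phi.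

Lemma cocycleN u v : u != v -> phi v u = - phi u v.
Proof. exact: (proj1 phiZ). Qed.

Lemma cocycle3 u v w : face3 u v w ->
  kappa u != kappa v -> kappa v != kappa w -> kappa u != kappa w ->
  phi u v + phi v w = phi u w.
Proof. by move=> uvw uv vw uw; apply: (proj2 phiZ) => //; apply: neq_color. Qed.

Section ThreePerColor.

Hypothesis card3 : forall i, #|color_class i| = 3%N.

Lemma two_pairs_meet i u v u' v' : u != v -> u' != v' ->
  kappa u = i -> kappa v = i -> kappa u' = i -> kappa v' = i ->
  exists2 w, w \in [set u; v] & w \in [set u'; v'].
Proof.
move=> uv uv' ui vi ui' vi'.
have /set0Pn[w]: [set u; v] :&: [set u'; v'] != set0.
  apply/eqP => I0; have := cardsUI [set u; v] [set u'; v'].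
  rewrite I0 cards0 !cards2 uv uv' => E.
  have /subset_leq_card : [set u; v] :|: [set u'; v'] \subset color_class i.
    by rewrite !subUset !sub1set !inE ui vi ui' vi' eqxx.
  by rewrite card3; lia.
by rewrite inE => /andP[]; exists w.
Qed.

(** A potential on the edges with two given colours extends to the whole complex,
because the subgraph of these colours in the link of any other vertex is
connected: two of its vertices of one colour have at least two neighbours each
among the three vertices of the other colour. *)
Lemma coboundary_two_colors i j (f : V -> rat) : i != j ->
  (forall u v, kappa u = i -> kappa v = j -> edge u v -> phi u v = f v - f u) ->
  coboundary D phi.
Proof.
move=> ij fE.
pose in2 v := (kappa v == i) || (kappa v == j).
have [nbr nbrP] : exists nbr : V -> V, forall v,
    ~~ in2 v -> kappa (nbr v) = i /\ edge (nbr v) v.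
  apply: (@fin_all_exists V (fun=> V)
    (fun v u => ~~ in2 v -> kappa u = i /\ edge u v)) => v.
  case: (boolP (in2 v)) => [_|]; first by exists v.
  rewrite negb_or => /andP[vi _]; have [u [_ [_ ui _ uv _]]] := vertex_ext vi.
  by exists u; rewrite edgeC.
pose f' v := if in2 v then f v else f (nbr v) + phi (nbr v) v.
have tri u v w : kappa u = i -> kappa v = j -> ~~ in2 w -> face3 u v w ->
    f u + phi u w = f v + phi v w.
  move=> ui vj; rewrite negb_or => /andP[wi wj] uvw.
  have [uv uw vw] := face3_edge uvw.
  have := cocycle3 uvw; rewrite ui vj ij ![_ == kappa w]eq_sym wi wj.
  by rewrite (fE u v) // => /(_ isT isT isT); lra.
have tri_i u u' w : kappa u = i -> kappa u' = i -> ~~ in2 w ->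
    edge u w -> edge u' w -> f u + phi u w = f u' + phi u' w.
  move=> ui ui' w2; have := w2; rewrite negb_or => /andP[wi wj] uw uw'.
  have [|//|v1 [v2 [v12 v1j v2j F1 F2]]] := @edge_ext u w j uw; first by rewrite ui.
  have [|//|v3 [v4 [v34 v3j v4j F3 F4]]] := @edge_ext u' w j uw'; first by rewrite ui'.
  have [v v_12 v_34] := two_pairs_meet v12 v34 v1j v2j v3j v4j.
  have [vj F F'] : [/\ kappa v = j, face3 u w v & face3 u' w v].
    by split; [move: v_12|move: v_12|move: v_34]; rewrite !inE => /orP[]/eqP->.
  by rewrite (tri u v) 1?face3CA // (tri u' v) 1?face3CA.
have f'E u w : in2 u -> ~~ in2 w -> edge u w -> f' w = f' u + phi u w.
  move=> u2 w2 uw; rewrite /f' u2 (negPf w2).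
  move: (nbr w) (nbrP w w2) => u0 [u0i u0w].
  have [ui|/eqP ui] := eqVneq (kappa u) i; first exact: tri_i.
  have uj : kappa u = j by move: u2; rewrite /in2; case: eqP => // _ /eqP.
  have := w2; rewrite negb_or => /andP[wi _].
  have [||v [_ [_ vi _ F _]]] := @edge_ext u w i uw; rewrite ?uj 1?eq_sym //.
    by rewrite eq_sym.
  have F' : face3 v u w by rewrite face3C face3CA.
  by rewrite -(tri v u) // (tri_i u0 v) //; have [] := face3_edge F'.
exists f' => u v uv uvD; have cuv := twofold_color hD uv uvD.
have [u2|u2] := boolP (in2 u); have [v2|v2] := boolP (in2 v).
- rewrite /f' u2 v2; move: u2 v2 cuv; rewrite /in2.
  case: eqP => [ui _|_ /eqP uj]; case: eqP => [vi _|_ /= /eqP vj].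
  + by rewrite ui vi eqxx.
  + by move=> _; apply: fE.
  + by move=> _; rewrite cocycleN 1?eq_sym // (fE v u) 1?edgeC // opprB.
  + by rewrite uj vj eqxx.
- by rewrite (f'E u v) //; ring.
- by rewrite cocycleN 1?eq_sym // (f'E v u) 1?edgeC //; ring.
have [ui vi] : kappa u != i /\ kappa v != i.
  by move: u2 v2; rewrite !negb_or => /andP[-> _] /andP[-> _].
have [w [_ [_ wi _ F _]]] := edge_ext uvD ui vi.
have F' : face3 w u v by rewrite face3C face3CA.
have [wu wv _] := face3_edge F'.
have w2 : in2 w by rewrite /in2 wi eqxx.
rewrite (f'E w u) // (f'E w v) // -(cocycle3 F') ?wi 1?eq_sym //; first ring.
by rewrite eq_sym.
Qed.

(** Each edge of colours [j], [k] lies in the link of two of the three vertices of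
colour [i], hence in the link of [a] or of [b]. If the potentials [phi a] and
[phi b] of these two links differ by a constant on their intersection, they glue
to a potential on all edges of these colours. *)
Lemma coboundary_two_cones i j k a b (c : rat) :
  i != j -> i != k -> j != k -> a != b -> kappa a = i -> kappa b = i ->
  (forall u, (kappa u == j) || (kappa u == k) -> edge a u -> edge b u ->
     phi a u - phi b u = c) ->
  coboundary D phi.
Proof.
move=> ij ik jk ab ai bi cE.
apply: (@coboundary_two_colors j k
  (fun u => if edge a u then phi a u else phi b u + c)) => //.
move=> u v uj vk uv.
have fa w : (kappa w == j) || (kappa w == k) -> edge b w ->
    (if edge a w then phi a w else phi b w + c) = phi b w + c.
  by case: ifP => // aw wjk bw; rewrite -(cE w) //; ring.
have [||x [y [xy xi yi Fx Fy]]] := @edge_ext u v i uv; rewrite ?uj ?vk 1?eq_sym //.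
have [w w_ab w_xy] := two_pairs_meet ab xy ai bi xi yi.
have F : face3 w u v.
  by rewrite face3C face3CA; move: w_xy; rewrite !inE => /orP[]/eqP->.
have wi : kappa w = i by move: w_ab; rewrite !inE => /orP[]/eqP->.
have [wu wv _] := face3_edge F.
have := cocycle3 F; rewrite wi uj vk ij jk ik => /(_ isT isT isT) E.
move: w_ab; rewrite !inE => /orP[]/eqP Ew; subst w.
  by rewrite wu wv -E; ring.
by rewrite !fa ?uj ?vk ?eqxx ?orbT // -E; ring.
Qed.

End ThreePerColor.

End Cocycle.

End Twofold.

(** * Triples of bipartite link graphs on 3 + 3 vertices *)

Section FiniteCheck.

Local Open Scope nat_scope.

(** Vertices of one colour are numbered by [I3], and permutations of [I3] are given by
their lists of values. *)
Definition I3 : seq nat := [:: 0; 1; 2].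

Definition perms3 : seq (seq nat) :=
  [:: [:: 0; 1; 2]; [:: 0; 2; 1]; [:: 1; 0; 2]; [:: 1; 2; 0]; [:: 2; 0; 1];
      [:: 2; 1; 0]].

Fixpoint bits n : seq bitseq :=
  if n is m.+1 then
    [seq true :: s | s <- bits m] ++ [seq false :: s | s <- bits m]
  else [:: [::]].

Lemma mem_bits (s : bitseq) : s \in bits (size s).
Proof.
elim: s => //= b s IHs; rewrite mem_cat.
by case: b; rewrite map_f // orbT.
Qed.

(** A bipartite graph on 3 + 3 vertices is encoded by its nine adjacency bits. *)
Definition adj (A : bitseq) b c := nth false A (3 * b + c).

Definition row_used A b := has (adj A b) I3.
Definition col_used A c := has (adj A^~ c) I3.

(** Whether the vertex [n] is not isolated; rows come first, then columns. *)
Definition covered A n := if n < 3 then row_used A n else col_used A (n - 3).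

Definition two_of (P : pred nat) :=
  has (fun a => has (fun b => (a != b) && P b) I3 && P a) I3.

(** Every nonisolated vertex has degree at least two, and at least two vertices
are nonisolated on each side. *)
Definition link_graph A :=
  [&& all (fun b => row_used A b ==> two_of (adj A b)) I3,
      all (fun c => col_used A c ==> two_of (adj A^~ c)) I3,
      two_of (row_used A) & two_of (col_used A)].

Definition link_graphs := [seq A <- bits 9 | link_graph A].

(** A 2-colouring of the vertices that is constant along the common edges. *)
Definition locally_constant A B (s : bitseq) :=
  all (fun b => all (fun c => if adj A b c && adj B b c then
    nth false s b == nth false s (3 + c) else true) I3) I3.

Definition common A B := [seq n <- iota 0 6 | covered A n && covered B n].

(** The intersection of the two graphs, formed by their common edges and common
nonisolated vertices, is disconnected. *)
Definition separated A B :=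
  let W := common A B in
  has (fun s => if has (nth false s) W && has (fun n => ~~ nth false s n) W
                then locally_constant A B s else false) (bits 6).

(** A family of three link graphs, one for each vertex of the first colour. *)
Definition pick3 (A B C : bitseq) a := nth [::] [:: A; B; C] a.

(** Each edge that lies in one of the graphs lies in two of them, and each vertex is
nonisolated in at least two of them. *)
Definition link_family A B C :=
  all (fun b => all (fun c => has (fun a => adj (pick3 A B C a) b c) I3 ==>
    two_of (fun a => adj (pick3 A B C a) b c)) I3) I3 &&
  all (fun n => two_of (fun a => covered (pick3 A B C a) n)) (iota 0 6).

Definition perm_of (s : seq nat) := nth 0 s.

(** Up to renumbering, [(a, b, c)] is a face when exactly two of [a], [b], [c] agree,
and not a face when they are distinct. Nothing is asked of [(a, a, a)]: without
these three triangles, the complex is the torus with nine vertices. *)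
Definition torus_like A B C :=
  has (fun m => has (fun n => all (fun a => all (fun b => all (fun c =>
    let t := adj (pick3 A B C a) (perm_of m b) (perm_of n c) in
    if [&& a != b, b != c & a != c] then ~~ t
    else if (a == b) && (b == c) then true else t) I3) I3) I3) perms3) perms3.

(** The sixteen triangles of a projective plane with nine vertices. *)
Definition rp2_faces : seq (nat * nat * nat) :=
  [:: (0, 1, 1); (0, 1, 2); (0, 2, 1); (0, 2, 2);
      (1, 0, 1); (1, 0, 2); (1, 1, 0); (1, 2, 0); (1, 1, 1); (1, 2, 2);
      (2, 0, 1); (2, 0, 2); (2, 1, 0); (2, 2, 0); (2, 1, 2); (2, 2, 1)].

Definition rp2_like A B C :=
  has (fun l => has (fun m => has (fun n => all (fun f =>
    adj (pick3 A B C (perm_of l f.1.1)) (perm_of m f.1.2) (perm_of n f.2))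
    rp2_faces) perms3) perms3) perms3.

(* Filters and conditionals, unlike boolean implications, evaluate the costly
tests only on the few families that pass the previous ones. *)
Definition check_pairs (L : seq bitseq) A :=
  all (fun B => all (fun C =>
    if torus_like A B C then true else rp2_like A B C)
    [seq C <- [seq C <- L | separated B C] | link_family A B C]) L.

Definition classification :=
  all (fun A => check_pairs [seq B <- link_graphs | separated A B] A) link_graphs.

(** An enumeration of the 49 possible link graphs and of their triples. *)
Lemma classificationP : classification.
Proof. by vm_compute. Qed.

Lemma classify_links A B C :
  size A = 9 -> size B = 9 -> size C = 9 ->
  link_graph A -> link_graph B -> link_graph C ->
  separated A B -> separated A C -> separated B C -> link_family A B C ->
  torus_like A B C \/ rp2_like A B C.
Proof.
move=> sA sB sC gA gB gC AB AC BC ABC.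
have inL E : size E = 9 -> link_graph E -> E \in link_graphs.
  by move=> sE gE; rewrite /link_graphs mem_filter gE -sE mem_bits.
have AL := inL A sA gA; have BL := inL B sB gB; have CL := inL C sC gC.
move: classificationP; rewrite /classification; move: link_graphs AL BL CL.
move=> L AL BL CL /allP/(_ A AL); rewrite /check_pairs => /allP/(_ B).
rewrite mem_filter AB => /(_ BL)/allP/(_ C).
rewrite !mem_filter ABC BC AC => /(_ CL).
by case: ifP => [_ _|_]; [left|right].
Qed.

End FiniteCheck.

(** * Labelling the vertices by three letters *)

Section Triples.

Variables (V : finType) (d : nat) (D : {set {set V}}) (kappa : V -> 'I_d).
Hypothesis hD : twofold_complex D kappa.
Hypothesis card3 : forall i, #|color_class kappa i| = 3%N.
Variable phi : V -> V -> rat.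
Hypotheses (phiZ : cocycle D phi) (phiB : ~ coboundary D phi).
Implicit Types (u v w : V) (i j k : 'I_d).

Local Notation edge := (edge D).
Local Notation face3 := (face3 D).

(** [x] numbers the vertices of colour [i] by the three letters. *)
Definition enumerates i (x : 'I_3 -> V) :=
  [/\ injective x, forall p, kappa (x p) = i &
      forall v, kappa v = i -> exists p, v = x p].

Lemma enumerates_inj i x : injective x -> (forall p, kappa (x p) = i) ->
  enumerates i x.
Proof.
move=> x_inj xi; split=> // v vi.
suff /imsetP[p _ ->] : v \in x @: 'I_3 by exists p.
have -> : x @: 'I_3 = color_class kappa i; last by rewrite inE vi.
apply/eqP; rewrite eqEcard card3 card_imset // card_ord leqnn andbT.
by apply/subsetP => _ /imsetP[p _ ->]; rewrite inE xi.
Qed.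

Lemma color_enumeration i : exists x, enumerates i x.
Proof.
pose x (p : 'I_3) := enum_val (cast_ord (esym (card3 i)) p).
exists x; apply: enumerates_inj => [p q /enum_val_inj/cast_ord_inj //|p].
by have := enum_valP (cast_ord (esym (card3 i)) p); rewrite inE => /eqP.
Qed.

Section Links.

Variables (i j k : 'I_d) (x y z : 'I_3 -> V).
Hypotheses (ij : i != j) (ik : i != k) (jk : j != k).
Hypotheses (hx : enumerates i x) (hy : enumerates j y) (hz : enumerates k z).

Let X a := x (inord a).
Let Y b := y (inord b).
Let Z c := z (inord c).
(* The vertices of the link graphs: first colour [j], then colour [k]. *)
Let W n := if (n < 3)%N then Y n else Z (n - 3).
Let T a b c := face3 (X a) (Y b) (Z c).
Let lk a := [seq T a (n %/ 3)%N (n %% 3)%N | n <- iota 0 9].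

Let Xi a : kappa (X a) = i. Proof. by case: hx => _ + _; apply. Qed.
Let Yj b : kappa (Y b) = j. Proof. by case: hy => _ + _; apply. Qed.
Let Zk c : kappa (Z c) = k. Proof. by case: hz => _ + _; apply. Qed.

Let lt3 (a : nat) : a \in I3 -> (a < 3)%N.
Proof. by rewrite !inE => /or3P[]/eqP->. Qed.

Let enum_inj l (u : 'I_3 -> V) (a b : nat) : enumerates l u ->
  a \in I3 -> b \in I3 -> u (inord a) = u (inord b) -> a = b.
Proof. by case=> uI _ _ /lt3 a3 /lt3 b3 /uI/(congr1 val); rewrite /= !inordK. Qed.

Let ord_I3 (p : 'I_3) : (p : nat) \in I3.
Proof. by case: p => [[|[|[|]]]]. Qed.

Let enum_I3 l (u : 'I_3 -> V) v : enumerates l u -> kappa v = l ->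
  exists2 a, a \in I3 & v = u (inord a).
Proof.
case=> _ _ + vl => /(_ v vl)[p ->]; exists (nat_of_ord p); first exact: ord_I3.
by rewrite inord_val.
Qed.

Lemma two_of_color l (u : 'I_3 -> V) v w (Q : pred nat) : enumerates l u ->
  v != w -> kappa v = l -> kappa w = l ->
  {in I3, forall a, (u (inord a) == v) || (u (inord a) == w) -> Q a} -> two_of Q.
Proof.
move=> hu + vl wl QP; have [a aI Ea] := enum_I3 hu vl.
have [b bI Eb] := enum_I3 hu wl; rewrite {1}Ea {1}Eb => ab.
apply/hasP; exists b; rewrite // QP ?Eb ?eqxx ?orbT // andbT.
apply/hasP; exists a; rewrite // QP ?Ea ?eqxx //.
by rewrite andbT eq_sym; apply: contraNneq ab => ->.
Qed.

Let adjE a b c : b \in I3 -> c \in I3 -> adj (lk a) b c = T a b c.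
Proof. by rewrite !inE => /or3P[]/eqP-> /or3P[]/eqP->. Qed.

Let rowP a b : b \in I3 -> edge (X a) (Y b) -> two_of (adj (lk a) b).
Proof.
move=> bI ab; have [||v [w [vw vk wk Fv Fw]]] := @edge_ext _ _ _ _ hD _ _ k ab.
- by rewrite Xi.
- by rewrite Yj.
apply: (two_of_color hz vw vk wk) => c cI; rewrite adjE // /T /Z.
by case/orP => /eqP->.
Qed.

Let colP a c : c \in I3 -> edge (X a) (Z c) -> two_of ((adj (lk a))^~ c).
Proof.
move=> cI ac; have [||v [w [vw vj wj Fv Fw]]] := @edge_ext _ _ _ _ hD _ _ j ac.
- by rewrite Xi.
- by rewrite Zk eq_sym.
apply: (two_of_color hy vw vj wj) => b bI; rewrite adjE // /T /Y face3CA.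
by case/orP => /eqP->.
Qed.

Lemma two_of_has P : two_of P -> has P I3.
Proof. by case/hasP => a aI /andP[_ Pa]; apply/hasP; exists a. Qed.

Let rowE a b : b \in I3 -> row_used (lk a) b = edge (X a) (Y b).
Proof.
move=> bI; apply/idP/idP => [/hasP[c cI]|/(rowP bI)/two_of_has //].
by rewrite adjE // => /(face3_edge hD)[].
Qed.

Let colE a c : c \in I3 -> col_used (lk a) c = edge (X a) (Z c).
Proof.
move=> cI; apply/idP/idP => [/hasP[b bI]|/(colP cI)/two_of_has //].
by rewrite adjE // => /(face3_edge hD)[].
Qed.

Let coveredE a n : n \in iota 0 6 -> covered (lk a) n = edge (X a) (W n).
Proof.
rewrite mem_iota => /andP[_ n6]; rewrite /covered /W; case: ltnP => n3.
  by rewrite rowE //; move: n n3 {n6} => [|[|[|]]].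
by rewrite colE //; move: n n3 n6 => [|[|[|[|[|[|]]]]]].
Qed.

Let link_graph_lk a : link_graph (lk a).
Proof.
apply/and4P; split.
- by apply/allP => b bI; rewrite rowE //; apply/implyP/rowP.
- by apply/allP => c cI; rewrite colE //; apply/implyP/colP.
- have [|v [w [vw vj wj av aw]]] := @vertex_ext _ _ _ _ hD (X a) j.
    by rewrite Xi.
  apply: (two_of_color hy vw vj wj) => b bI; rewrite rowE // /Y.
  by case/orP => /eqP->.
- have [|v [w [vw vk wk av aw]]] := @vertex_ext _ _ _ _ hD (X a) k.
    by rewrite Xi.
  apply: (two_of_color hz vw vk wk) => c cI; rewrite colE // /Z.
  by case/orP => /eqP->.
Qed.

Let pick_lk a : a \in I3 -> pick3 (lk 0) (lk 1) (lk 2) a = lk a.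
Proof. by rewrite !inE => /or3P[]/eqP->. Qed.

Let link_family_lk : link_family (lk 0) (lk 1) (lk 2).
Proof.
apply/andP; split.
  apply/allP => b bI; apply/allP => c cI; apply/implyP => /hasP[a aI].
  rewrite pick_lk // adjE // => /(face3_edge hD)[_ _ bc].
  have [||v [w [vw vi wi Fv Fw]]] := @edge_ext _ _ _ _ hD _ _ i bc.
  - by rewrite Yj eq_sym.
  - by rewrite Zk eq_sym.
  apply: (two_of_color hx vw vi wi) => a' aI'.
  rewrite pick_lk // adjE // /T /X face3C face3CA.
  by case/orP => /eqP->.
apply/allP => n n6.
have [|v [w [vw vi wi nv nw]]] := @vertex_ext _ _ _ _ hD (W n) i.
  by rewrite /W; case: ifP; rewrite ?Yj ?Zk eq_sym.
apply: (two_of_color hx vw vi wi) => a aI.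
by rewrite pick_lk // coveredE // edgeC /X; case/orP => /eqP->.
Qed.

(** Otherwise the potentials [phi (X a)] and [phi (X b)] differ by a constant on
the intersection of the two links, and [phi] is a coboundary. *)
Let separated_lk a b : a \in I3 -> b \in I3 -> a != b -> separated (lk a) (lk b).
Proof.
move=> aI bI ab; apply: contra_notT phiB => nsep.
pose g u := phi (X a) u - phi (X b) u.
pose n0 := head 0%N (common (lk a) (lk b)).
apply: (@coboundary_two_cones _ _ _ _ hD _ phiZ card3 i j k
  (X a) (X b) (g (W n0))) => //.
  by apply: contraNneq ab => /(enum_inj hx aI bI) ->.
move=> u ujk au bu; rewrite -/(g u).
have [m m6 Eu] : exists2 m, m \in iota 0 6 & u = W m.
  case/orP: ujk => /eqP.
    case/(enum_I3 hy) => m mI ->; exists m.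
      by rewrite mem_iota; move: mI; rewrite !inE => /or3P[]/eqP->.
    by rewrite /W; move: mI; rewrite !inE => /or3P[]/eqP->.
  case/(enum_I3 hz) => m mI ->; exists (3 + m)%N.
    by rewrite mem_iota; move: mI; rewrite !inE => /or3P[]/eqP->.
  by rewrite /W addKn; move: mI; rewrite !inE => /or3P[]/eqP->.
subst u; have mW : m \in common (lk a) (lk b).
  by rewrite mem_filter m6 !coveredE // au bu.
have n0W : n0 \in common (lk a) (lk b).
  by rewrite /n0; case: (common _ _) mW => //= n s _; rewrite mem_head.
apply/eqP; apply: contraNT nsep => gm.
pose s := [seq g (W n) == g (W n0) | n <- iota 0 6].
have sE n : (n < 6)%N -> nth false s n = (g (W n) == g (W n0)).
  by move=> n6; rewrite (nth_map 0%N) ?size_iota // nth_iota.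
have in6 n : n \in common (lk a) (lk b) -> (n < 6)%N.
  by rewrite mem_filter mem_iota => /andP[].
apply/hasP; exists s; first by rewrite -[6%N]/(size s) mem_bits.
rewrite ifT.
  apply/allP => c cI; apply/allP => e eI; case: ifP => // /andP[].
  rewrite !adjE // => Fa Fb.
  have := cocycle3 phiZ (Fa : face3 (X a) (Y c) (Z e)).
  move/(_ d kappa); rewrite Xi Yj Zk => /(_ ij jk ik) Ea.
  have := cocycle3 phiZ (Fb : face3 (X b) (Y c) (Z e)).
  move/(_ d kappa); rewrite Xi Yj Zk => /(_ ij jk ik) Eb.
  have /andP[c3 e3] : (c < 3)%N && (e < 3)%N.
    by move: cI eI; rewrite !inE => /or3P[]/eqP-> /or3P[]/eqP->.
  rewrite (sE c (leq_trans c3 (isT : 3 <= 6)%N)) (sE (3 + e)%N); last first.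
    by rewrite (ltn_add2l 3 e 3).
  have -> : g (W c) = g (W (3 + e)%N); last by rewrite eqxx.
  by rewrite /W c3 ltnNge leq_addr /= addKn /g -Ea -Eb; ring.
apply/andP; split; apply/hasP.
  by exists n0; rewrite // sE ?in6 ?eqxx.
by exists m; rewrite // sE ?in6.
Qed.

Let classified :
  torus_like (lk 0) (lk 1) (lk 2) \/ rp2_like (lk 0) (lk 1) (lk 2).
Proof.
apply: classify_links.
1-3: by rewrite size_map size_iota.
1-3: exact: link_graph_lk.
1-3: exact: separated_lk.
exact: link_family_lk.
Qed.

Let perm_I3 s a : s \in perms3 -> a \in I3 -> perm_of s a \in I3.
Proof.
move=> sP aI.
by have /allP/(_ s sP)/allP/(_ a aI) :
  all (fun s => all (fun a => perm_of s a \in I3) I3) perms3 by [].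
Qed.

Let perm_inj3 s a b : s \in perms3 -> a \in I3 -> b \in I3 ->
  perm_of s a = perm_of s b -> a = b.
Proof.
move=> sP aI bI /eqP E; apply/eqP; move: E; apply/implyP.
have /allP/(_ s sP)/allP/(_ a aI)/allP/(_ b bI) // : all (fun s => all (fun a =>
  all (fun b => (perm_of s a == perm_of s b) ==> (a == b)) I3) I3) perms3 by [].
Qed.

Let perm_surj3 s a : s \in perms3 -> a \in I3 -> exists2 b, b \in I3 & a = perm_of s b.
Proof.
move=> sP aI.
have /allP/(_ s sP)/allP/(_ a aI)/hasP[b bI /eqP E] : all (fun s => all (fun a =>
  has (fun b => a == perm_of s b) I3) I3) perms3 by [].
by exists b.
Qed.

(** Two of the three links of colour [i] meet in a disconnected graph, but the
sixteen triangles force the potentials to differ by the same constant on both of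
its components. The relations only give twice the difference of the two
constants, so this step uses that 2 is invertible. *)
Let not_rp2_like : ~ rp2_like (lk 0) (lk 1) (lk 2).
Proof.
case/hasP => l lP /hasP[m mP /hasP[n nP /allP F]].
pose p a b := phi (X (perm_of l a)) (Y (perm_of m b)).
pose q a c := phi (X (perm_of l a)) (Z (perm_of n c)).
pose r b c := phi (Y (perm_of m b)) (Z (perm_of n c)).
have E f : f \in rp2_faces -> p f.1.1 f.1.2 + r f.1.2 f.2 = q f.1.1 f.2.
  move=> fF; have := F f fF.
  have [aI bI cI] : [/\ f.1.1 \in I3, f.1.2 \in I3 & f.2 \in I3].
    apply/and3P; move: f fF; apply/allP; exact: isT.
  rewrite pick_lk ?adjE ?perm_I3 // => Ff.
  have := @cocycle3 _ d _ kappa _ phiZ _ _ _ Ff.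
  by rewrite Xi Yj Zk; apply.
move: (E (0, 1, 1)%N isT) (E (0, 1, 2)%N isT) (E (0, 2, 1)%N isT)
  (E (0, 2, 2)%N isT) (E (1, 0, 1)%N isT) (E (1, 0, 2)%N isT)
  (E (1, 1, 0)%N isT) (E (1, 2, 0)%N isT) (E (1, 1, 1)%N isT)
  (E (1, 2, 2)%N isT) (E (2, 0, 1)%N isT) (E (2, 0, 2)%N isT)
  (E (2, 1, 0)%N isT) (E (2, 2, 0)%N isT) (E (2, 1, 2)%N isT)
  (E (2, 2, 1)%N isT) => /=.
move=> E1 E2 E3 E4 E5 E6 E7 E8 E9 E10 E11 E12 E13 E14 E15 E16.
apply: phiB; apply: (@coboundary_two_cones _ _ _ _ hD _ phiZ card3 i j k
  (X (perm_of l 1)) (X (perm_of l 2)) (p 1 0 - p 2 0)) => //.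
  have I1 : 1%N \in I3 by [].
  have I2 : 2%N \in I3 by [].
  apply/eqP => /(enum_inj hx (perm_I3 lP I1) (perm_I3 lP I2)).
  by move/(perm_inj3 lP I1 I2).
move=> u /orP[]/eqP.
  case/(enum_I3 hy) => b bI -> _ _.
  have [c cI ->] := perm_surj3 mP bI; rewrite -/(Y _) -/(p 1 c) -/(p 2 c).
  by move: cI; rewrite !inE => /or3P[]/eqP->; lra.
case/(enum_I3 hz) => b bI -> _ _.
have [c cI ->] := perm_surj3 nP bI; rewrite -/(Z _) -/(q 1 c) -/(q 2 c).
by move: cI; rewrite !inE => /or3P[]/eqP->; lra.
Qed.

(** The three colours span a complex of the torus type; the letters of the colour [i]
being given, those of [j] and [k] follow. *)
Lemma triple_labels : exists M N : 'I_3 -> V,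
  [/\ enumerates j M, enumerates k N,
      forall p q r, p != q -> q != r -> p != r -> ~~ face3 (x p) (M q) (N r) &
      forall p q r, [|| p == q, q == r | p == r] -> ~~ ((p == q) && (q == r)) ->
        face3 (x p) (M q) (N r)].
Proof.
case: classified => [|/not_rp2_like //].
case/hasP => m mP /hasP[n nP /allP F].
exists (fun p => Y (perm_of m p)), (fun p => Z (perm_of n p)).
have TE (p q r : 'I_3) :
    adj (pick3 (lk 0) (lk 1) (lk 2) p) (perm_of m q) (perm_of n r) =
    face3 (x p) (Y (perm_of m q)) (Z (perm_of n r)).
  by rewrite pick_lk // adjE ?perm_I3 // /T /X inord_val.
split.
- apply: enumerates_inj => // p q.
  by move/(enum_inj hy (perm_I3 mP (ord_I3 p)) (perm_I3 mP (ord_I3 q)));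
    move/(perm_inj3 mP (ord_I3 p) (ord_I3 q))/val_inj.
- apply: enumerates_inj => // p q.
  by move/(enum_inj hz (perm_I3 nP (ord_I3 p)) (perm_I3 nP (ord_I3 q)));
    move/(perm_inj3 nP (ord_I3 p) (ord_I3 q))/val_inj.
- move=> p q r pq qr pr.
  have /allP/(_ _ (ord_I3 q))/allP/(_ _ (ord_I3 r)) := F _ (ord_I3 p).
  by rewrite /= TE !(inj_eq val_inj) pq qr pr.
- move=> p q r e ne.
  have /allP/(_ _ (ord_I3 q))/allP/(_ _ (ord_I3 r)) := F _ (ord_I3 p).
  rewrite /= TE !(inj_eq val_inj) (negPf ne) ifF //.
  by apply: contraTF e => /and3P[/negPf-> /negPf-> /negPf->].
Qed.

End Links.

Lemma third_ord n (i j : 'I_n) : (3 <= n)%N -> exists2 k, k != i & k != j.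
Proof.
move=> n3; have /set0Pn[k] : ~: [set i; j] != set0.
  rewrite -card_gt0 cardsCs setCK card_ord cards2.
  by case: (_ != _); lia.
by rewrite !inE negb_or => /andP[]; exists k.
Qed.

Lemma ord3_cases (a b c s : 'I_3) : a != b -> b != c -> a != c ->
  [|| s == a, s == b | s == c].
Proof.
by move: a b c s => [[|[|[|?]]] ?] [[|[|[|?]]] ?] [[|[|[|?]]] ?] [[|[|[|?]]] ?].
Qed.

Lemma ord3_other (a b : 'I_3) : exists2 c, c != a & c != b.
Proof. exact: third_ord. Qed.

Section Labels.

Hypothesis d3 : (3 <= d)%N.

(** The 1-skeleton is the complete multipartite graph. *)
Lemma rainbow_edge u v : kappa u != kappa v -> edge u v.
Proof.
move=> uv; have [k ku kv] := third_ord (kappa u) (kappa v) d3.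
have [x hx] := color_enumeration (kappa u).
have [y hy] := color_enumeration (kappa v).
have [z hz] := color_enumeration k.
have [||M [N [hM _ _ F]]] := triple_labels uv _ _ hx hy hz; rewrite 1?eq_sym //.
have [_ _ /(_ u erefl)[p Eu]] := hx; have [_ _ /(_ v erefl)[q Ev]] := hM.
suff [r Fr] : exists r, face3 u v (N r) by have [] := face3_edge hD Fr.
rewrite Eu Ev; have [pq|pq] := eqVneq p q; last first.
  by exists p; apply: F; rewrite ?eqxx ?orbT // (negPf pq).
have [r rp _] := ord3_other p p.
by exists r; apply: F; rewrite pq ?eqxx //= eq_sym -pq.
Qed.

(** Letters for the colours [j] and [k], compatible with the letters [x] of a third
colour: no face carries three distinct letters. *)
Definition triple_labelling j k (x M N : 'I_3 -> V) :=
  [/\ enumerates j M, enumerates k N &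
      forall p q r, p != q -> q != r -> p != r -> ~~ face3 (x p) (M q) (N r)].

(** The matching of the letters of two colours does not depend on the third colour
used to define it. If [M p = M' w] with [w != p], let [P] have colour [l] and the
third letter of [M', N']: then [x p], [M p], [P] is not a face, the edge [x p], [P]
extends to both other vertices [M y], [M z] of colour [j], and the face
[x p], [P], [N y] extends in colour [j] only to [M y]. *)
Lemma triple_labelling_unique i j k l (x M N M' N' : 'I_3 -> V) :
  i != j -> i != k -> j != k -> i != l -> j != l -> k != l ->
  enumerates i x -> triple_labelling j k x M N -> triple_labelling j l x M' N' ->
  M =1 M'.
Proof.
move=> ij ik jk il jl kl [xI xi _] [[MI Mj Ms] [NI Nk Ns] F] [[_ _ Ms'] [_ Nl _] F'] p.
have [w Ew] := Ms' _ (Mj p).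
have [wp|wp] := eqVneq w p; first by rewrite Ew wp.
have [u uw up] := ord3_other w p.
pose P := N' u.
have nX : ~~ face3 (x p) P (M p).
  by rewrite face3CA Ew; apply: F'; rewrite // eq_sym.
have xP : edge (x p) P by apply: rainbow_edge; rewrite xi Nl.
have [||v1 [v2 [v12 v1j v2j F1 F2]]] := @edge_ext _ _ _ _ hD _ _ j xP.
- by rewrite xi.
- by rewrite Nl eq_sym.
have [y Ey] := Ms _ v1j; have [z Ez] := Ms _ v2j; subst v1 v2.
have yz : y != z by apply: contraNneq v12 => ->.
have py : p != y by apply: contraNneq nX => E; move: F1; rewrite -E.
have pz : p != z by apply: contraNneq nX => E; move: F2; rewrite -E.
have FyPy : face3 (x p) P (N y).
  have [|||t1 [t2 [t12 t1k t2k [A1 B1 C1] [A2 B2 C2]]]] :=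
    @face3_ext _ _ _ _ hD _ _ _ k F1.
  - by rewrite xi.
  - by rewrite Nl eq_sym.
  - by rewrite Mj.
  have [r1 E1] := Ns _ t1k; have [r2 E2] := Ns _ t2k; subst t1 t2.
  have nz r : face3 (N r) (x p) (M y) -> r != z.
    apply: contraTneq => ->; rewrite face3C face3CA; apply: F => //.
  have [/eqP|r1y] := boolP (r1 == y).
    by move=> <-; rewrite face3CA face3C.
  have [/eqP|r2y] := boolP (r2 == y).
    by move=> <-; rewrite face3CA face3C.
  case/negP: t12; have := ord3_cases r1 py yz pz; have := ord3_cases r2 py yz pz.
  rewrite (negPf (nz _ B1)) (negPf (nz _ B2)) (negPf r1y) (negPf r2y) !orbF.
  by move=> /eqP-> /eqP->.
have [|||t1 [t2 [t12 t1j t2j [A1 B1 C1] [A2 B2 C2]]]] :=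
  @face3_ext _ _ _ _ hD _ _ _ j FyPy.
- by rewrite xi.
- by rewrite Nl eq_sym.
- by rewrite Nk eq_sym.
have [s1 E1] := Ms _ t1j; have [s2 E2] := Ms _ t2j; subst t1 t2.
have np s : face3 (M s) (x p) P -> s != p.
  by apply: contraTneq => ->; rewrite face3C face3CA.
have nz s : face3 (M s) (x p) (N y) -> s != z.
  by apply: contraTneq => ->; rewrite face3C; apply: F; rewrite // eq_sym.
case/negP: t12; have := ord3_cases s1 py yz pz; have := ord3_cases s2 py yz pz.
rewrite (negPf (nz _ B1)) (negPf (nz _ B2)) (negPf (np _ A1)) (negPf (np _ A2)).
by rewrite /= !orbF => /eqP-> /eqP->.
Qed.

Definition three_letter_free (lab : 'I_d -> 'I_3 -> V) i j k :=
  forall p q r, p != q -> q != r -> p != r ->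
    ~~ face3 (lab i p) (lab j q) (lab k r).

Lemma three_letter_freeC lab i j k :
  three_letter_free lab i j k -> three_letter_free lab j i k.
Proof. by move=> F p q r pq qr pr; rewrite face3C; apply: F; rewrite // eq_sym. Qed.

Lemma three_letter_freeCA lab i j k :
  three_letter_free lab i j k -> three_letter_free lab i k j.
Proof. by move=> F p q r pq qr pr; rewrite face3CA; apply: F; rewrite // eq_sym. Qed.

(** A face with the three letters [p], [q], [r] in the colours [i], [j], [k] would
extend in colour [t] only to the vertex with letter [p]. *)
Lemma three_letter_free_ext lab t i j k : (forall i, enumerates i (lab i)) ->
  t != i -> t != j -> t != k ->
  three_letter_free lab t i j -> three_letter_free lab t i k ->
  three_letter_free lab i j k.
Proof.
move=> labP ti tj tk Fj Fk p q r pq qr pr; apply/negP => F.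
have lk l m : kappa (lab l m) = l by have [] := labP l.
have [|||u1 [u2 [u12 u1t u2t [A1 B1 C1] [A2 B2 C2]]]] :=
  @face3_ext _ _ _ _ hD _ _ _ t F; rewrite ?lk 1?eq_sym //.
have [_ _ surj] := labP t.
have [s1 E1] := surj _ u1t; have [s2 E2] := surj _ u2t; subst u1 u2.
have nr s : face3 (lab t s) (lab i p) (lab j q) -> s != r.
  by apply: contraTneq => ->; apply: Fj; rewrite // eq_sym.
have nq s : face3 (lab t s) (lab i p) (lab k r) -> s != q.
  by apply: contraTneq => ->; apply: Fk; rewrite // eq_sym.
case/negP: u12; have := ord3_cases s1 pq qr pr; have := ord3_cases s2 pq qr pr.
rewrite (negPf (nr _ A1)) (negPf (nr _ A2)) (negPf (nq _ B1)) (negPf (nq _ B2)).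
by rewrite /= !orbF => /eqP-> /eqP->.
Qed.

Lemma labelling_exists : exists lab : 'I_d -> 'I_3 -> V,
  (forall i, enumerates i (lab i)) /\
  forall i j k, i != j -> j != k -> i != k -> three_letter_free lab i j k.
Proof.
pose i0 : 'I_d := Ordinal (leq_trans (isT : 0 < 3)%N d3).
have [i1 i10 _] := third_ord i0 i0 d3.
have [i2 i20 i21] := third_ord i0 i1 d3.
have [x hx] := color_enumeration i0.
have [MN MNP] : exists MN : 'I_d -> ('I_3 -> V) * ('I_3 -> V), forall k,
    k != i0 -> k != i1 -> triple_labelling i1 k x (MN k).1 (MN k).2.
  apply: (@fin_all_exists _ (fun=> _) (fun k MN =>
    k != i0 -> k != i1 -> triple_labelling i1 k x MN.1 MN.2)) => k.
  have [->|k0] := eqVneq k i0; first by exists (x, x).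
  have [->|k1] := eqVneq k i1; first by exists (x, x).
  have [y hy] := color_enumeration i1; have [z hz] := color_enumeration k.
  have [|||M [N [hM hN F _]]] := triple_labels _ _ _ hx hy hz; rewrite 1?eq_sym //.
  by exists (M, N).
pose M := (MN i2).1.
have hM k : k != i0 -> k != i1 -> (MN k).1 =1 M.
  move=> k0 k1; have [-> //|k2] := eqVneq k i2.
  by apply: (triple_labelling_unique _ _ _ _ _ _ hx (MNP k k0 k1) (MNP i2 i20 i21));
    rewrite // eq_sym.
pose lab k := if k == i0 then x else if k == i1 then M else (MN k).2.
have labP k : enumerates k (lab k).
  rewrite /lab; have [->//|k0] := eqVneq k i0.
  have [->|k1] := eqVneq k i1; first by have [] := MNP i2 i20 i21.
  by have [] := MNP k k0 k1.
have F01 k : k != i0 -> k != i1 -> three_letter_free lab i0 i1 k.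
  move=> k0 k1 p q r pq qr pr; rewrite /lab eqxx (negPf i10) eqxx.
  rewrite (negPf k0) (negPf k1) -(hM k k0 k1).
  by have [_ _] := MNP k k0 k1; apply.
have F0 j k : j != i0 -> k != i0 -> j != k -> three_letter_free lab i0 j k.
  move=> j0 k0 jk; have [j1|j1] := eqVneq j i1.
    by rewrite j1; apply: F01; rewrite // -j1 eq_sym.
  have [k1|k1] := eqVneq k i1.
    by rewrite k1; apply/three_letter_freeCA/F01.
  apply: (@three_letter_free_ext lab i1); rewrite // 1?eq_sym //.
    exact/three_letter_freeC/F01.
  exact/three_letter_freeC/F01.
exists lab; split=> // i j k ij jk ik.
have [i_0|ni0] := eqVneq i i0.
  by rewrite i_0; apply: F0; rewrite -?i_0 // eq_sym.
have [j_0|nj0] := eqVneq j i0.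
  by rewrite j_0; apply/three_letter_freeC/F0; rewrite -?j_0 // eq_sym.
have [k_0|nk0] := eqVneq k i0.
  by rewrite k_0; apply/three_letter_freeCA/three_letter_freeC/F0.
by apply: (@three_letter_free_ext lab i0); rewrite 1?eq_sym //; apply: F0.
Qed.

End Labels.

End Triples.

(** * Recognition of BM_d from a labelling *)

Lemma ord3_consecutive (p q : 'I_3) : exists2 r,
  (p == r) || (p == ordS r) & (q == r) || (q == ordS r).
Proof.
have : [|| q == p, q == ordS p | p == ordS q].
  by move: p q => [[|[|[|?]]] ?] [[|[|[|?]]] ?].
by case/or3P => E; [exists p | exists p | exists q]; rewrite ?E ?eqxx ?orbT.
Qed.

Section Isomorphism.

Variables (V : finType) (d : nat) (D : {set {set V}}) (kappa : V -> 'I_d).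
Hypotheses (hd : (2 <= d)%N) (hD : twofold_complex D kappa).
Hypothesis ridgeD : forall F, F \in D -> #|F| = d.-1 ->
  #|[set v | (v \notin F) && (v |: F \in D)]| = 2%N.
Variable lab : 'I_d -> 'I_3 -> V.
Hypothesis labP : forall i, enumerates kappa i (lab i).
Hypothesis edgeD : forall i j p q, i != j -> p != q -> edge D (lab i p) (lab j q).
Hypothesis freeD : forall i j k, i != j -> j != k -> i != k ->
  three_letter_free D lab i j k.
Implicit Types (F G : {set V}) (a : 'I_d -> 'I_3) (p q : 'I_3) (i j : 'I_d).

Let clD : closed_family D := twofold_closed hD.

Let lab_color i p : kappa (lab i p) = i. Proof. by have [] := labP i. Qed.

Let lab_surj v : exists p, v = lab (kappa v) p.
Proof. by have [_ _] := labP (kappa v); apply. Qed.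

Lemma lab_inj i j p q : lab i p = lab j q -> i = j /\ p = q.
Proof.
move=> E; have ij : i = j by rewrite -(lab_color i p) E lab_color.
by split=> //; move: E; rewrite ij; have [inj _ _] := labP j => /inj.
Qed.

(** The transversal of the colour classes spelled by [a]. *)
Definition word a : {set V} := [set lab i (a i) | i : 'I_d].

Lemma face_in_word F : F \in D -> exists2 a, word a \in D & F \subset word a.
Proof.
move=> FD; have [G /maxsetP[GD Gmax] FG] :=
  @maxset_exists _ (fun G => G \in D) _ FD.
have v0 : V by exact: lab (Ordinal (ltnW hd)) ord0.
have [w [wD wG0 Gw]] : exists G', [/\ G' \in D, G' != set0 & G \subset G'].
  have [G0|G0] := eqVneq G set0; last by exists G.
  exists [set v0]; rewrite (twofold_vertex hD) G0 sub0set; split=> //.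
  by apply/set0Pn; exists v0; rewrite inE.
have Gw' : w = G by apply: Gmax.
rewrite {w wD Gw}Gw' in wG0.
have surjG i : exists p, lab i p \in G.
  case: (pickP [pred v in G | kappa v == i]) => [v /= /andP[vG /eqP vi]|none].
    by have [p Ev] := lab_surj v; exists p; rewrite -vi -Ev.
  have [|u [_ [_ ui _ uD _]]] := @twofold_ext _ _ _ _ hD _ i GD wG0.
    by move=> v vG; have := none v; rewrite /= vG /= => ->.
  have uG : u \in G by rewrite -(Gmax _ uD (subsetUr _ _)) setU11.
  by have := none u; rewrite /= uG ui eqxx.
have [a aG] := fin_all_exists surjG.
have aG' : word a \subset G by apply/subsetP => _ /imsetP[i _ ->].
exists a; first exact: clD GD aG'.
apply/subsetP => v /(subsetP FG) vG; have [p Ev] := lab_surj v.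
apply/imsetP; exists (kappa v) => //; apply/eqP; apply: contraTT isT => nv.
have := @twofold_color _ _ _ _ hD v (lab (kappa v) (a (kappa v))) nv.
rewrite lab_color eqxx; apply; apply: clD GD _.
by rewrite subUset !sub1set vG aG.
Qed.

(** As [ordS] is the cyclic successor on the letters, any two letters are of the form
[p], [ordS p]. *)
Lemma word_two_letters a : word a \in D ->
  exists p, forall i, (a i == p) || (a i == ordS p).
Proof.
move=> aD; pose used p := [exists i, a i == p].
have [m nm] : exists m, ~~ used m.
  apply/existsP; rewrite -negb_forall; apply/negP => /forallP all_used.
  have /existsP[i /eqP ai] := all_used (inord 0).
  have /existsP[j /eqP aj] := all_used (inord 1).
  have /existsP[k /eqP ak] := all_used (inord 2).
  have ne (l m : 'I_d) : a l != a m -> l != m by apply: contraNneq => ->.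
  have aij : a i != a j by rewrite ai aj -(inj_eq val_inj) /= !inordK.
  have ajk : a j != a k by rewrite aj ak -(inj_eq val_inj) /= !inordK.
  have aik : a i != a k by rewrite ai ak -(inj_eq val_inj) /= !inordK.
  have := freeD (ne _ _ aij) (ne _ _ ajk) (ne _ _ aik) aij ajk aik.
  case/negP; apply: clD aD _; rewrite !subUset !sub1set.
  by rewrite !imset_f.
exists (ordS m) => i; have : a i != m.
  by apply: contra nm => /eqP E; apply/existsP; exists i; rewrite E.
by move: (a i) m {nm} => [[|[|[|?]]] ?] [[|[|[|?]]] ?].
Qed.

(** Starting from an edge with both letters, colours are added one at a time;
each time, the third letter is excluded, and two extensions exist, so both
letters occur. *)
Lemma nonconstant_word_face a p : (forall i, (a i == p) || (a i == ordS p)) ->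
  (exists i j, a i != a j) -> word a \in D.
Proof.
move=> ap [i [j aij]]; have ij : i != j by apply: contraNneq aij => ->.
suff wS n : (n <= d)%N -> exists S : {set 'I_d},
    [/\ i \in S, j \in S, (n <= #|S|)%N & [set lab l (a l) | l in S] \in D].
  have [S [_ _ dS SD]] := wS d (leqnn d).
  suff ES : S = setT.
    apply: clD SD _; apply/subsetP => _ /imsetP[l _ ->].
    by apply: imset_f; rewrite ES inE.
  by apply/eqP; rewrite eqEcard subsetT cardsT card_ord.
elim: n => [_|n IHn nd].
  exists [set i; j]; rewrite !inE !eqxx orbT; split=> //.
  by rewrite imsetU1 imset_set1; apply: edgeD.
have [S [iS jS nS SD]] := IHn (ltnW nd).
have [Sn|Sn] := ltnP n #|S|; first by exists S.
have /set0Pn[t] : ~: S != set0 by rewrite -card_gt0 cardsCs setCK card_ord; lia.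
rewrite inE => tS.
have [||u [v [uv ut vt uD vD]]] := @twofold_ext _ _ _ _ hD _ t SD.
- by apply/set0Pn; exists (lab i (a i)); apply: imset_f.
- by move=> _ /imsetP[l lS ->]; rewrite lab_color; apply: contraNneq tS => <-.
have [s Eu] : exists s, u = lab t s by have [_ _] := labP t; apply.
have [r Ev] : exists r, v = lab t r by have [_ _] := labP t; apply.
have sr : s != r by apply: contraNneq uv => E; rewrite Eu Ev E.
have ti : i != t by apply: contraNneq tS => <-.
have tj : j != t by apply: contraNneq tS => <-.
have two q : lab t q |: [set lab l (a l) | l in S] \in D -> (q == a i) || (q == a j).
  move=> qD; apply: contraTT (qD); rewrite negb_or => /andP[qi qj].
  apply: contraL qD => qD; have := freeD ij tj ti aij _ _; move=> /(_ q).
  rewrite 1?eq_sym qj 1?eq_sym qi => /(_ isT isT) /negP[].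
  apply: clD qD _; rewrite !subUset !sub1set setU11 !inE !imset_f ?orbT //.
have at_ij : (a t == a i) || (a t == a j).
  have := ap t; case/orP: (ap i) aij => /eqP->; case/orP: (ap j) => /eqP->;
    by rewrite ?eqxx // orbC.
have at_ : (a t == s) || (a t == r).
  move: (two s) (two r); rewrite -Eu -Ev uD vD => /(_ isT) + /(_ isT).
  case/orP => /eqP Es; case/orP => /eqP Er; move: sr at_ij;
    by rewrite Es Er ?eqxx // orbC.
exists (t |: S); rewrite !inE iS jS !orbT cardsU1 tS; split=> //.
  by rewrite imsetU1; case/orP: at_ => /eqP->; rewrite -?Eu -?Ev.
Qed.

(** A codimension one face with a single letter is contained in the two
nonconstant words, hence in no other facet. *)
Lemma constant_word_nonface p : word (fun=> p) \notin D.
Proof.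
apply/negP => pD; pose i : 'I_d := Ordinal (ltnW hd).
pose j : 'I_d := Ordinal hd.
pose F := [set lab l p | l in [set~ i]].
have inF q : lab i q \notin F.
  by apply/imsetP => -[l]; rewrite !inE => /eqP li /lab_inj[/esym].
have FD : F \in D.
  by apply: clD pD _; apply/subsetP => _ /imsetP[l _ ->]; apply: imset_f.
have cF : #|F| = d.-1.
  rewrite card_in_imset => [|l m _ _ /lab_inj[] //].
  by rewrite cardsCs setCK cards1 card_ord subn1.
have ext q : lab i q |: F \in D.
  pose a l := if l == i then q else p.
  have Ea : word a = lab i q |: F.
    apply/setP => v; apply/imsetP/setU1P => [[l _ ->]|[->|/imsetP[l]]].
    - rewrite /a; case: eqP => [->|/eqP li]; [by left|right].
      by apply: imset_f; rewrite !inE.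
    - by exists i; rewrite // /a eqxx.
    - by rewrite !inE => li ->; exists l; rewrite // /a (negPf li).
  rewrite -Ea; have [qp|qp] := eqVneq q p.
    by move: pD; congr (_ \in D); apply: eq_imset => l; rewrite /a qp if_same.
  have [r qr pr] := ord3_consecutive q p.
  apply: (@nonconstant_word_face a r).
    by move=> l; rewrite /a; case: ifP.
  by exists i, j; rewrite /a eqxx (_ : j == i = false).
have := ridgeD FD cF.
suff : (3 <= #|[set v | (v \notin F) && (v |: F \in D)]|)%N by move=> + E; rewrite E.
have labi : injective (lab i) by have [] := labP i.
rewrite -[3%N]card_ord -(card_imset _ labi); apply: subset_leq_card.
by apply/subsetP => _ /imsetP[q _ ->]; rewrite inE inF ext.
Qed.

Lemma labelled_isomorphic : complex_isomorphic D (BM d).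
Proof.
pose g (x : 'I_3 * 'I_d) := lab x.2 x.1.
have [f fK] : exists f : V -> 'I_3 * 'I_d, forall v, v = g (f v).
  apply: (@fin_all_exists _ (fun=> _) (fun v x => v = g x)) => v.
  by have [p Ev] := lab_surj v; exists (p, kappa v).
have gK : cancel g f.
  move=> [p i]; have := fK (g (p, i)); rewrite {1}/g /g /=.
  by case: (f _) => q j /= /lab_inj[-> ->].
exists f; first by exists g.
pose bmset a : {set 'I_3 * 'I_d} := [set (a i, i) | i : 'I_d].
have fword a : f @: word a = bmset a.
  rewrite /word -imset_comp; apply: eq_imset => i /=.
  by rewrite -[lab i _]/(g (a i, i)) gK.
have fgK (F : {set V}) : g @: (f @: F) = F.
  rewrite -imset_comp -[RHS]imset_id; apply: eq_imset => v /=.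
  by rewrite -fK.
move=> F; rewrite inE; apply/idP/existsP => [FD|[G /andP[/andP[]]]].
  have [a aD Fa] := face_in_word FD.
  exists (bmset a); rewrite -fword imsetS // andbT; apply/andP; split.
    have [p ap] := word_two_letters aD.
    apply/existsP; exists p; apply/existsP; exists [ffun i => a i].
    apply/andP; split; first by apply/forallP => i; rewrite ffunE.
    by rewrite fword; apply/eqP/eq_imset => i; rewrite ffunE.
  apply/forallP => p; apply/negP => /eqP E.
  case/negP: (constant_word_nonface p); move: aD.
  suff -> : word a = word (fun=> p) by [].
  by rewrite -[LHS]fgK -[RHS]fgK E fword.
case/existsP => p /existsP[a /andP[/forallP ap /eqP EG]] /forallP Gn FG.
have aD : word a \in D.
  apply: (nonconstant_word_face ap).
  pose i0 : 'I_d := Ordinal (ltnW hd).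
  have := Gn (a i0); rewrite EG => ne; exists i0.
  apply/existsP; apply: contraR ne; rewrite negb_exists => /forallP eqa.
  by apply/eqP/eq_imset => j; have := eqa j; rewrite negbK => /eqP ->.
apply: clD aD _; rewrite -[F]fgK -[word a]fgK imsetS //.
by rewrite fword; move: FG; rewrite EG.
Qed.

End Isomorphism.

(** * Colour classes of homology manifolds *)

Section ManifoldColors.

Variables (V : finType) (d : nat) (D : {set {set V}}) (kappa : V -> 'I_d).
Hypotheses (hd : (2 <= d)%N) (hD : simplicial_complex D).
Hypothesis hman : homology_manifold d D.
Hypothesis hkappa :
  forall u v, u != v -> [set u; v] \in D -> kappa u != kappa v.
Hypothesis hV : #|V| = (3 * d)%N.
Implicit Types (u v w : V) (i j : 'I_d).

Local Notation edge := (edge D).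
Local Notation face3 := (face3 D).

Lemma manifold_twofold : twofold_complex D kappa.
Proof.
case: (hD) => clD vD; split=> //.
by move=> F i; apply: face_two_extensions.
Qed.

Let tfD := manifold_twofold.

Lemma sum_color_class : (\sum_i #|color_class kappa i|)%N = (3 * d)%N.
Proof.
rewrite -hV -sum1_card (partition_big kappa xpredT) //=.
by apply: eq_bigr => i _; rewrite -sum1dep_card.
Qed.

Lemma color_class_two i : exists u v, [/\ u != v, kappa u = i & kappa v = i].
Proof.
have /card_gt0P[v _] : (0 < #|V|)%N by rewrite hV; lia.
have [vi|vi] := eqVneq (kappa v) i; last first.
  by have [x [y [xy xi yi _ _]]] := vertex_ext tfD vi; exists x, y.
have [j ji] : exists j, j != i.
  have /card_gt0P[j] : (0 < #|[set~ i]|)%N.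
    by rewrite cardsCs setCK cards1 card_ord; lia.
  by rewrite !inE; exists j.
have [|u [_ [_ uj _ _ _]]] := vertex_ext tfD (u := v) (i := j).
  by rewrite vi eq_sym.
have [|x [y [xy xi yi _ _]]] := vertex_ext tfD (u := u) (i := i).
  by rewrite uj.
by exists x, y.
Qed.

(** If a colour class is a pair [a], [b], the complex is the suspension of the link
of [a], which is connected in dimension at least two. *)
Lemma color_class_ge3 phi : (3 <= d)%N -> cocycle D phi -> ~ coboundary D phi ->
  forall i, (3 <= #|color_class kappa i|)%N.
Proof.
move=> d3 phiZ phiB i; rewrite leqNgt; apply/negP => small.
have [a [b [ab ai bi]]] := color_class_two i.
have abE v : kappa v = i -> (v == a) || (v == b).
  move=> vi; suff : v \in [set a; b] by rewrite !inE.
  have -> : [set a; b] = color_class kappa i; last by rewrite inE vi.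
  by apply/eqP; rewrite eqEcard subUset !sub1set !inE ai bi eqxx cards2 ab.
have ext F : F \in D -> F != set0 -> (forall v, v \in F -> kappa v != i) ->
    a |: F \in D /\ b |: F \in D.
  move=> FD F0 Fi; have [u [v [uv ui vi uF vF]]] := twofold_ext tfD FD F0 Fi.
  move: (abE u ui) (abE v vi) uv => /orP[]/eqP Eu /orP[]/eqP Ev; subst u v;
    by rewrite ?eqxx.
have color_neq u : (u != a) -> (u != b) -> kappa u != i.
  by move=> ua ub; apply/eqP => /abE; rewrite (negPf ua) (negPf ub).
have cone1 u : kappa u != i -> edge a u /\ edge b u.
  move=> ui; apply: ext; first exact: (twofold_vertex tfD).
    by apply/set0Pn; exists u; rewrite inE.
  by move=> v; rewrite inE => /eqP->.
have cone2 u v : edge u v -> kappa u != i -> kappa v != i ->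
    face3 a u v /\ face3 b u v.
  move=> uv ui vi; rewrite /face3 -!setUA; apply: ext => //.
    by apply/set0Pn; exists u; rewrite !inE eqxx.
  by move=> w; rewrite !inE => /orP[]/eqP->.
pose h u := phi a u - phi b u.
have hE u v : u != v -> edge u v -> kappa u != i -> kappa v != i -> h u = h v.
  move=> uv uvD ui vi; have [Fa Fb] := cone2 u v uvD ui vi.
  have cuv := hkappa uv uvD; have := cocycle3 phiZ Fa (kappa := kappa).
  rewrite ai cuv 2!(eq_sym i) ui vi => /(_ isT isT isT) Ea.
  have := cocycle3 phiZ Fb (kappa := kappa).
  rewrite bi cuv 2!(eq_sym i) ui vi => /(_ isT isT isT) Eb.
  by rewrite /h -Ea -Eb; ring.
have La u : kappa u != i -> [set u] \in link D [set a].
  move=> ui; have [au _] := cone1 u ui.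
  rewrite link_vertex // setUC -/(edge a u) au inE andbT; apply: contraNneq ui => ->.
  by rewrite ai.
have h_const u v : kappa u != i -> kappa v != i -> h u = h v.
  move=> ui vi; apply: (@betti0_connected _ (link D [set a]) h).
  - exact: link_closed.
  - rewrite hman ?(twofold_vertex tfD) //; last by apply/set0Pn; exists a; rewrite inE.
    by rewrite /sphere_reduced_betti cards1; apply/eqP; rewrite eqb0; lia.
  - move=> x y xy; rewrite in_link // => /andP[dis FD].
    have color_x w : w \in [set x; y] -> kappa w != i.
      move=> wxy; have wa : w != a.
        by apply: contraTneq dis => <-; rewrite disjoint_sym disjoints1 wxy.
      rewrite -ai; apply: hkappa => //; apply: (proj1 hD) FD _.
      by rewrite subUset !sub1set !inE eqxx orbT andbT; move: wxy; rewrite !inE => ->.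
    apply: hE => //; try by apply: color_x; rewrite !inE eqxx ?orbT.
    by apply: (proj1 hD) FD _; apply: subsetUl.
  - exact: La.
  - exact: La.
have [o oi] : exists o, kappa o != i.
  have [k ki _] := third_ord i i d3; have [o [_ [_ ok _]]] := color_class_two k.
  by exists o; rewrite ok.
apply: phiB.
exists (fun u => if u == a then 0 else if u == b then h o else phi a u).
have star_b u : kappa u != i -> phi b u = phi a u - h o.
  by move=> ui; rewrite -(h_const u o ui oi) /h; ring.
have ba : b != a by rewrite eq_sym.
move=> u v uv uvD; have cuv := hkappa uv uvD.
have [Eu|ua] := eqVneq u a.
  rewrite Eu in uv uvD cuv *.
  have va : v != a by rewrite eq_sym.
  have vb : v != b by apply: contraNneq cuv => ->; rewrite ai bi.
  by rewrite (negPf va) (negPf vb) subr0.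
have [Eu|ub] := eqVneq u b.
  rewrite Eu in uv uvD cuv *.
  have vb : v != b by rewrite eq_sym.
  have va : v != a by apply: contraNneq cuv => ->; rewrite ai bi.
  by rewrite (negPf va) (negPf vb) star_b //; apply: color_neq.
have ui := color_neq u ua ub.
have [Ev|va] := eqVneq v a.
  by rewrite Ev sub0r (cocycleN phiZ) // eq_sym.
have [Ev|vb] := eqVneq v b.
  rewrite Ev (cocycleN phiZ (u := b)) ?star_b //; first ring.
  by rewrite eq_sym.
have vi := color_neq v va vb; have [Fa _] := cone2 u v uvD ui vi.
have := cocycle3 phiZ Fa (kappa := kappa).
rewrite ai cuv 2!(eq_sym i) ui vi => /(_ isT isT isT) <-; ring.
Qed.

Lemma color_class_card3 phi : (3 <= d)%N -> cocycle D phi -> ~ coboundary D phi ->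
  forall i, #|color_class kappa i| = 3%N.
Proof.
move=> d3 phiZ phiB i; have ge3 := color_class_ge3 d3 phiZ phiB.
have [_] := leqif_sum (fun j (_ : true) => leqif_eq (ge3 j)).
rewrite sum_nat_const card_ord sum_color_class mulnC eqxx.
by move/esym/forallP/(_ i)/eqP->.
Qed.

End ManifoldColors.

Section Dimension2.

Variables (V : finType) (D : {set {set V}}) (kappa : V -> 'I_2).
Hypothesis hD : twofold_complex D kappa.
Hypothesis ridgeD : forall F, F \in D -> #|F| = 1%N ->
  #|[set v | (v \notin F) && (v |: F \in D)]| = 2%N.
Hypothesis hV : #|V| = 6%N.

Local Notation edge := (edge D).

Let other_color (i : 'I_2) j : j != i -> j = ordS i.
Proof. by move: i j => [[|[|?]] ?] [[|[|?]] ?] // _; apply: val_inj. Qed.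

Let nbr u := [set v | (v != u) && edge u v].

Let card_nbr u : #|nbr u| = 2%N.
Proof.
rewrite -(ridgeD (twofold_vertex hD u) (cards1 u)); apply: eq_card => v.
by rewrite !inE /edge [[set u; v]]setUC.
Qed.

Let nbr_sym u v : (v \in nbr u) = (u \in nbr v).
Proof. by rewrite !inE eq_sym edgeC. Qed.

Let nbr_color i u v : kappa u = i -> v \in nbr u -> kappa v = ordS i.
Proof.
move=> ui; rewrite inE => /andP[vu uv]; apply: other_color.
by rewrite -ui; apply: (twofold_color hD) => //; rewrite -/(edge v u) edgeC.
Qed.

(** Counting the edges by their end of either colour. *)
Lemma bipartite_color_class i : #|color_class kappa i| = 3%N.
Proof.
have cnt j : (\sum_(u in color_class kappa j) \sum_(v in color_class kappa (ordS j))
    (v \in nbr u : nat) = #|color_class kappa j| * 2)%N.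
  rewrite -sum_nat_const; apply: eq_bigr => u; rewrite inE => /eqP uj.
  rewrite -[RHS](card_nbr u) -sum1_card big_mkcond [RHS]big_mkcond /=.
  apply: eq_bigr => v _; case: (boolP (v \in nbr u)) => [vu|]; last by case: ifP.
  by rewrite inE (nbr_color uj vu) eqxx.
have i2 : ordS (ordS i) = i by move: i => [[|[|?]] ?] //; apply: val_inj.
have := cnt i; rewrite exchange_big /=.
under eq_bigr => v _ do under eq_bigr => u _ do rewrite nbr_sym.
have := cnt (ordS i); rewrite i2 => -> /eqP; rewrite eqn_pmul2r // => /eqP E.
have : (#|color_class kappa i| + #|color_class kappa (ordS i)| = 6)%N.
  rewrite -hV -cardsT -cardsUI addnC (_ : _ :&: _ = set0) ?cards0.
    congr #|pred_of_set _|; apply/setP => v; rewrite !inE -[RHS](orbN (kappa v == i)).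
    congr (_ || _); apply/eqP/idP => [->|/other_color //].
    by move: (i) => [[|[|?]] ?].
  apply/setP => v; rewrite !inE; apply/andP => -[/eqP-> /eqP/esym/eqP].
  by move: (i) => [[|[|?]] ?].
by rewrite E; lia.
Qed.

(** In the hexagon, each vertex gets the letter of its opposite vertex. *)
Lemma hexagon_labelling : exists lab : 'I_2 -> 'I_3 -> V,
  (forall i, enumerates kappa i (lab i)) /\
  forall i j p q, i != j -> p != q -> edge (lab i p) (lab j q).
Proof.
have [x hx] := color_enumeration bipartite_color_class ord0.
have [xI x0 xS] := hx.
have [y yP] : exists y : 'I_3 -> V, forall p,
    kappa (y p) = ordS ord0 /\ y p \notin nbr (x p).
  apply: (@fin_all_exists _ (fun=> _) (fun p v =>
    kappa v = ordS ord0 /\ v \notin nbr (x p))) => p.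
  have /subsetPn[v] : ~~ (color_class kappa (ordS ord0) \subset nbr (x p)).
    apply/negP => /subset_leq_card.
    by rewrite bipartite_color_class card_nbr.
  by rewrite inE => /eqP v1 vn; exists v.
have adj p q : p != q -> edge (x p) (y q).
  move=> pq; have [y1 yn] := yP q.
  suff : x p \in nbr (y q) by rewrite inE edgeC => /andP[].
  suff -> : nbr (y q) = color_class kappa ord0 :\ x q.
    by rewrite !inE x0 eqxx andbT (inj_eq xI).
  apply/eqP; rewrite eqEcard card_nbr; apply/andP; split.
    apply/subsetP => v vy; rewrite !inE (nbr_color y1 vy) andbC /=.
    by apply: contraNneq yn => <-; rewrite nbr_sym.
  have := cardsD1 (x q) (color_class kappa ord0).
  by rewrite bipartite_color_class inE x0 eqxx add1n => -[<-].
have hy : enumerates kappa (ordS ord0) y.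
  apply: (enumerates_inj bipartite_color_class) => [p q E|p]; last by case: (yP p).
  apply/eqP; apply: contraTT isT => pq.
  have [y1 yn] := yP q; case/negP: yn; rewrite -E nbr_sym.
  have := adj q p; rewrite eq_sym pq => /(_ isT) e.
  rewrite inE edgeC e andbT; apply/eqP => xy.
  by have := x0 q; rewrite xy; have [-> _] := yP p.
exists (fun i => if i == ord0 then x else y); split=> [i|i j p q].
  case: eqP => [->//|/eqP/other_color-> //].
move=> ij pq; have [i0|i1] := eqVneq i ord0; have [j0|j1] := eqVneq j ord0.
- by rewrite i0 j0 eqxx in ij.
- exact: adj.
- by rewrite edgeC; apply: adj; rewrite eq_sym.
- by rewrite (other_color i1) (other_color j1) eqxx in ij.
Qed.

End Dimension2.

Theorem theorem3p6 (d : nat) (V : finType) (D : {set {set V}})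
    (hd : (2 <= d)%N)
    (hD : simplicial_complex D)
    (hdim : complex_dim D = (d%:Z - 1)%R)
    (hbal : balanced d D)
    (hV : #|V| = (3 * d)%N)
    (hman : homology_manifold d D)
    (hb1 : reduced_betti D 1%Z <> 0%N)
    (hb2 : reduced_betti D 2%Z = 0%N) :
  complex_isomorphic D (BM d).
Proof.
case: hbal => kappa hkappa.
have tfD := manifold_twofold hd hD hman hkappa.
have ridgeD F := ridge_two_facets hd hD hman hkappa (F := F).
have [d3|d2] := leqP 3 d.
  have [phi phiZ phiB] := betti1_cocycle (proj1 hD) hb1.
  have card3 := color_class_card3 hd hD hman hkappa hV d3 phiZ phiB.
  have [lab [labP free]] := labelling_exists tfD card3 phiZ phiB d3.
  apply: (labelled_isomorphic hd tfD ridgeD labP _ free) => i j p q ij _.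
  apply: (rainbow_edge tfD card3 phiZ phiB d3).
  by have [_ -> _] := labP i; have [_ -> _] := labP j.
have Ed : d = 2%N by lia.
subst d; have [lab [labP adj]] := hexagon_labelling tfD ridgeD hV.
apply: (labelled_isomorphic hd tfD ridgeD labP adj).
by move=> [[|[|?]] ?] [[|[|?]] ?] [[|[|?]] ?].
Qed.
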